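(* Let $\mathcal H$ be a Hilbert space and let $U\colon[0,1]\to\mathcal U_1(\mathcal H)$ be continuous with $U(0)=1$. Then the eigenvalues of $U(x)$ (counting multiplicities) can be enumerated as $e^{i\theta_j(x)}$, $j=1,2,\dots$, in such a way that each function $\theta_j\colon[0,1]\to\mathbb R$ is continuous and $\theta_j(0)=0$ for all $j$.
   Context: $\mathcal U_1(\mathcal H)$ is the group of unitary operators on $\mathcal H$ of the form $1+A$ with $A$ trace class, with the topology of the trace norm $\|U-V\|_1$. The enumeration is understood with the eigenvalue $1$ counted with infinite multiplicity (i.e. for each $x$, the values $e^{i\theta_j(x)}\neq1$ list the eigenvalues of $U(x)$ different from $1$ with their multiplicities, and infinitely many $j$ give the value $1$). *)

(* Defs.v *)
From HB Require Import structures.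
From mathcomp Require Import all_boot all_order all_algebra.
From mathcomp Require Import all_classical all_reals all_analysis.
From mathcomp Require Import complex.
Set Implicit Arguments. Unset Strict Implicit. Unset Printing Implicit Defensive.
Import Order.TTheory GRing.Theory Num.Theory.
Import numFieldNormedType.Exports.
Local Open Scope ring_scope.

Section HilbertDefs.
Variables (R : realType) (V : lmodType R[i]).

Definition is_inner_product (ip : V -> V -> R[i]) : Prop :=
  [/\ (forall (a : R[i]) (x y z : V), ip (a *: x + y) z = a * ip x z + ip y z),
      (forall x y : V, ip y x = conjc (ip x y)),
      (forall x : V, @complex.Im R (ip x x) = 0 /\ 0 <= @complex.Re R (ip x x)) &
      (forall x : V, ip x x = 0 -> x = 0)].

Definition hnorm (ip : V -> V -> R[i]) (x : V) : R := Num.sqrt (@complex.Re R (ip x x)).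

Definition hcomplete (ip : V -> V -> R[i]) : Prop :=
  forall u : nat -> V,
    (forall eps : R, 0 < eps -> exists N : nat, forall m n : nat,
        (N <= m)%N -> (N <= n)%N -> hnorm ip (u m - u n) < eps) ->
    exists l : V, forall eps : R, 0 < eps -> exists N : nat, forall n : nat,
        (N <= n)%N -> hnorm ip (u n - l) < eps.

Definition hilbert_space (ip : V -> V -> R[i]) : Prop :=
  is_inner_product ip /\ hcomplete ip.

Definition is_linear_op (T : V -> V) : Prop :=
  forall (a : R[i]) (x y : V), T (a *: x + y) = a *: T x + T y.

Definition orthonormal (ip : V -> V -> R[i]) (n : nat) (e : 'I_n -> V) : Prop :=
  forall i j : 'I_n, ip (e i) (e j) = (if i == j then 1 else 0).

(* Trace norm ||A||_1 = sup over pairs of finite orthonormal families (e_i), (f_i)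
   of sum_i |<A e_i, f_i>|  (= tr|A| for trace class A, +oo otherwise). *)
Definition trace_norm (ip : V -> V -> R[i]) (A : V -> V) : \bar R :=
  ereal_sup [set r : \bar R | exists (n : nat) (e f : 'I_n -> V),
      [/\ orthonormal ip e, orthonormal ip f &
           r = ((\sum_(i < n) Normc.normc (ip (A (e i)) (f i)))%:E)%E]]%classic.

Definition in_U1 (ip : V -> V -> R[i]) (U : V -> V) : Prop :=
  [/\ is_linear_op U,
      (forall y : V, exists x : V, U x = y),
      (forall x y : V, ip (U x) (U y) = ip x y) &
      (trace_norm ip (fun v => (U v - v)%R) < +oo)%E].

Definition eig_mult (ip : V -> V -> R[i]) (T : V -> V) (lam : R[i]) (n : nat) : Prop :=
  (exists e : 'I_n -> V, orthonormal ip e /\ forall i, T (e i) = lam *: e i) /\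
  (forall (m : nat) (e : 'I_m -> V), orthonormal ip e ->
      (forall i, T (e i) = lam *: e i) -> (m <= n)%N).

End HilbertDefs.

Definition expi (R : realType) (t : R) : R[i] := (cos t +i* sin t)%C.

(* Main.v *)
Require Import Defs.
From HB Require Import structures.
From mathcomp Require Import all_boot all_order all_algebra.
From mathcomp Require Import all_classical all_reals all_analysis.
From mathcomp Require Import complex.
From mathcomp Require Import ring lra.
Set Implicit Arguments.
Unset Strict Implicit.
Unset Printing Implicit Defensive.
Import Order.TTheory GRing.Theory Num.Theory.
Import numFieldNormedType.Exports.
Local Open Scope ring_scope.

(* Fix a time x0 and an angle alpha such that expi alpha is not an eigenvalue of U(x0),
   hence of no U(x) with x close to x0. The eigenvalues of U(x) accumulate only at 1, so
   their angles in ]0, alpha[ can be listed in decreasing order, padded with 0, and those in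
   ]alpha, 2 pi[ symmetrically from 2 pi downwards. The n-th angle is continuous in x because
   the number of eigenvalues in an arc whose endpoints are not eigenvalues is locally
   constant. For this last fact, an arc is the trace on the circle of a half-plane
   Re (conj w z) > c, and the count of eigenvalues in it is read off the quadratic form
   Re <conj w U v, v>: it is > c on the span of the eigenvectors in the arc and <= c on
   the orthogonal complement, and both survive small perturbations by a dimension count.
   Local enumerations over two adjacent intervals [a, b] and [b, c], each padded with
   infinitely many zero functions, take every value equally often at b, so they can be
   matched by a bijection of the indices and glued; the angles are then only shifted by
   multiples of 2 pi. A supremum argument covers [0, 1]. *)

(** * Inner product spaces *)

Section ComplexAux.
Variable R : realType.
Implicit Types z w : R[i].

Definition csq z : R := complex.Re z ^+ 2 + complex.Im z ^+ 2.

Lemma ReD z w : complex.Re (z + w) = complex.Re z + complex.Re w.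
Proof. by case: z => a b; case: w. Qed.

Lemma ReN z : complex.Re (- z) = - complex.Re z.
Proof. by case: z. Qed.

Lemma ReB z w : complex.Re (z - w) = complex.Re z - complex.Re w.
Proof. by rewrite ReD ReN. Qed.

Lemma Re_sum n (F : 'I_n -> R[i]) :
  complex.Re (\sum_i F i) = \sum_i complex.Re (F i).
Proof. exact: (big_morph _ ReD). Qed.

Lemma ReZ (a : R) z : complex.Re (a%:C%C * z) = a * complex.Re z.
Proof. by case: z => x y /=; rewrite mul0r subr0. Qed.

Lemma Re_conj z : complex.Re (conjc z) = complex.Re z.
Proof. by case: z. Qed.

Lemma csq_ge0 z : 0 <= csq z.
Proof. by rewrite addr_ge0 ?sqr_ge0. Qed.

Lemma mul_conjc z : z * conjc z = (csq z)%:C%C.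
Proof.
by case: z => a b; apply/eqP; rewrite eq_complex /csq /=; apply/andP; split;
  apply/eqP; ring.
Qed.

Lemma csq_eq0 z : csq z = 0 -> z = 0.
Proof.
case: z => a b /eqP; rewrite /csq /= paddr_eq0 ?sqr_ge0 // !sqrf_eq0.
by move=> /andP[/eqP-> /eqP->].
Qed.

Lemma csqC (a : R) : csq a%:C%C = a ^+ 2.
Proof. by rewrite /csq /= expr0n addr0. Qed.

Lemma normc_csq z : Normc.normc z = Num.sqrt (csq z).
Proof. by case: z. Qed.

Lemma normc_ge0 z : 0 <= Normc.normc z.
Proof. by rewrite normc_csq sqrtr_ge0. Qed.

Lemma ler_Re_normc z : `|complex.Re z| <= Normc.normc z.
Proof.
by rewrite normc_csq -sqrtr_sqr ler_wsqrtr // /csq lerDl sqr_ge0.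
Qed.

End ComplexAux.

(** For positive [C] the polynomial is tested at its vertex [- B / C]. For [C = 0] it is affine, and
    a nonzero [B] would let it take the value -1. *)
Lemma discriminant_le (R : realType) (A B C : R) : 0 <= C ->
  (forall t : R, 0 <= A + 2 * t * B + t ^+ 2 * C) -> B ^+ 2 <= A * C.
Proof.
rewrite le_eqVlt => /predU1P[<-|C0] h.
  have [->|B0] := eqVneq B 0; first by rewrite expr0n mulr0.
  have := h (- (A + 1) / (2 * B)).
  have -> : A + 2 * (- (A + 1) / (2 * B)) * B + (- (A + 1) / (2 * B)) ^+ 2 * 0
    = -1 by field.
  lra.
have := h (- B / C).
have -> : A + 2 * (- B / C) * B + (- B / C) ^+ 2 * C = (A * C - B ^+ 2) / C.
  by field; lra.
by rewrite pmulr_lge0 ?invr_gt0 // subr_ge0.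
Qed.

Section InnerProduct.
Variables (R : realType) (V : lmodType R[i]) (ip : V -> V -> R[i]).
Hypothesis hip : is_inner_product ip.
Implicit Types (u v w x y : V) (a : R[i]).

Definition nsq v : R := complex.Re (ip v v).

Lemma ipC u v : ip v u = conjc (ip u v).
Proof. by case: hip. Qed.

Lemma ipDl u v w : ip (u + v) w = ip u w + ip v w.
Proof. by case: hip => h _ _ _; rewrite -[u]scale1r h mul1r scale1r. Qed.

Lemma ip0l w : ip 0 w = 0.
Proof. by apply: (addrI (ip 0 w)); rewrite -ipDl !addr0. Qed.

Lemma ipZl a v w : ip (a *: v) w = a * ip v w.
Proof. by case: hip => h _ _ _; rewrite -[a *: v]addr0 h ip0l addr0. Qed.

Lemma ipNl v w : ip (- v) w = - ip v w.
Proof. by rewrite -scaleN1r ipZl mulN1r. Qed.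

Lemma ipBl u v w : ip (u - v) w = ip u w - ip v w.
Proof. by rewrite ipDl ipNl. Qed.

Lemma ipDr u v w : ip w (u + v) = ip w u + ip w v.
Proof. by rewrite ipC ipDl rmorphD /= -!ipC. Qed.

Lemma ipZr a v w : ip w (a *: v) = conjc a * ip w v.
Proof. by rewrite ipC ipZl rmorphM /= -!ipC. Qed.

Lemma ip0r w : ip w 0 = 0.
Proof. by rewrite ipC ip0l conjc0. Qed.

Lemma ipNr v w : ip w (- v) = - ip w v.
Proof. by rewrite ipC ipNl rmorphN /= -ipC. Qed.

Lemma ip_suml n (F : 'I_n -> V) w : ip (\sum_i F i) w = \sum_i ip (F i) w.
Proof. by elim/big_ind2: _ => [|x1 x2 y1 y2 <- <-|//]; rewrite ?ip0l ?ipDl. Qed.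

Lemma ip_sumr n (F : 'I_n -> V) w : ip w (\sum_i F i) = \sum_i ip w (F i).
Proof. by elim/big_ind2: _ => [|x1 x2 y1 y2 <- <-|//]; rewrite ?ip0r ?ipDr. Qed.

Lemma Re_ipC u v : complex.Re (ip v u) = complex.Re (ip u v).
Proof. by rewrite ipC Re_conj. Qed.

Lemma nsq_ge0 v : 0 <= nsq v.
Proof. by case: hip => _ _ h _; case: (h v). Qed.

Lemma ipvv v : ip v v = (nsq v)%:C%C.
Proof.
apply/eqP; rewrite eq_complex /nsq /= eqxx /=.
by case: hip => _ _ h _; case: (h v) => -> _.
Qed.

Lemma nsq_eq0 v : nsq v = 0 -> v = 0.
Proof. by case: hip => _ _ _ h e; apply: h; rewrite ipvv e. Qed.

Lemma nsq_gt0 v : v != 0 -> 0 < nsq v.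
Proof.
move=> v0; rewrite lt_neqAle nsq_ge0 andbT eq_sym.
by apply: contra v0 => /eqP/nsq_eq0 ->.
Qed.

Lemma nsq0 : nsq 0 = 0.
Proof. by rewrite /nsq ip0l. Qed.

Lemma nsqZ a v : nsq (a *: v) = csq a * nsq v.
Proof.
by rewrite /nsq ipZl ipZr mulrA mul_conjc ReZ.
Qed.

Lemma nsqD u v : nsq (u + v) = nsq u + nsq v + 2 * complex.Re (ip u v).
Proof.
by rewrite /nsq ipDl !ipDr !ReD (Re_ipC u v); ring.
Qed.

Lemma nsqN v : nsq (- v) = nsq v.
Proof. by rewrite /nsq ipNl ipNr opprK. Qed.

Lemma cauchy_schwarz u v : complex.Re (ip u v) ^+ 2 <= nsq u * nsq v.
Proof.
apply: discriminant_le => [|t]; first exact: nsq_ge0.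
suff -> : nsq u + 2 * t * complex.Re (ip u v) + t ^+ 2 * nsq v
  = nsq (u + t%:C%C *: v) by exact: nsq_ge0.
by rewrite nsqD nsqZ csqC ipZr conjc_real ReZ; ring.
Qed.

Local Notation N := (hnorm ip).

Lemma ipnormE v : N v = Num.sqrt (nsq v). Proof. by []. Qed.

Lemma ipnorm_ge0 v : 0 <= N v. Proof. exact: sqrtr_ge0. Qed.

Lemma sqr_ipnorm v : N v ^+ 2 = nsq v.
Proof. by rewrite sqr_sqrtr // nsq_ge0. Qed.

Lemma ipnorm_le v (c : R) : 0 <= c -> (N v <= c) = (nsq v <= c ^+ 2).
Proof. by move=> c0; rewrite -sqr_ipnorm ler_sqr // nnegrE ipnorm_ge0. Qed.

Lemma Re_ip_le u v : complex.Re (ip u v) <= N u * N v.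
Proof.
apply: le_trans (ler_norm _) _.
rewrite -sqrtrM ?nsq_ge0 // -sqrtr_sqr ler_wsqrtr //; exact: cauchy_schwarz.
Qed.

Lemma ipnormD u v : N (u + v) <= N u + N v.
Proof.
rewrite ipnorm_le ?addr_ge0 ?ipnorm_ge0 // nsqD sqrrD !sqr_ipnorm.
have := Re_ip_le u v; lra.
Qed.

Lemma ipnormN v : N (- v) = N v.
Proof. by rewrite !ipnormE nsqN. Qed.

Lemma ipnormC u v : N (u - v) = N (v - u).
Proof. by rewrite -ipnormN opprB. Qed.

Lemma ipnormB u v : N (u - v) <= N u + N v.
Proof. by rewrite -(ipnormN v) ipnormD. Qed.

Lemma ipnormZ a v : N (a *: v) = Normc.normc a * N v.
Proof. by rewrite !ipnormE nsqZ sqrtrM ?csq_ge0 // normc_csq. Qed.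

Lemma ipnorm_sum n (F : 'I_n -> V) : N (\sum_i F i) <= \sum_i N (F i).
Proof.
elim/big_ind2: _ => [|x1 x2 y1 y2 h1 h2|//]; first by rewrite ipnormE nsq0 sqrtr0.
exact: le_trans (ipnormD _ _) (lerD h1 h2).
Qed.

Lemma ipnorm0_eq0 v : N v = 0 -> v = 0.
Proof. by move=> h; apply: nsq_eq0; rewrite -sqr_ipnorm h expr0n. Qed.

(* Multiplying by a phase reduces the modulus to the real Cauchy-Schwarz inequality. *)
Lemma normc_ip_le u v : Normc.normc (ip u v) <= N u * N v.
Proof.
set z := ip u v; have [z0|z0] := eqVneq (csq z) 0.
  by rewrite normc_csq z0 sqrtr0 mulr_ge0 ?ipnorm_ge0.
have s0 : 0 < csq z by rewrite lt_neqAle eq_sym z0 csq_ge0.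
have := cauchy_schwarz (conjc z *: u) v.
rewrite ipZl mulrC mul_conjc /= nsqZ.
have -> : csq (conjc z) = csq z by case: (z) => a b; rewrite /csq /= sqrrN.
rewrite -mulrA expr2 ler_pM2l // => h.
rewrite normc_csq -sqrtrM ?nsq_ge0 // ler_wsqrtr //.
Qed.

Section Orthonormal.
Variables (n : nat) (e : 'I_n -> V).
Hypothesis he : Defs.orthonormal ip e.

Lemma ip_lincomb (a : 'I_n -> R[i]) j : ip (\sum_i a i *: e i) (e j) = a j.
Proof.
rewrite ip_suml (bigD1 j) //= ipZl he eqxx mulr1 big1 ?addr0 // => i ij.
by rewrite ipZl he (negPf ij) mulr0.
Qed.

Lemma nsq_orthonormal i : nsq (e i) = 1.
Proof. by rewrite /nsq he eqxx. Qed.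

Lemma ipnorm_orthonormal i : N (e i) = 1.
Proof. by rewrite ipnormE nsq_orthonormal sqrtr1. Qed.

Lemma ip_lincomb2 (a b : 'I_n -> R[i]) :
  ip (\sum_i b i *: e i) (\sum_i a i *: e i) = \sum_i b i * conjc (a i).
Proof.
rewrite ip_sumr; apply: eq_bigr => i _.
by rewrite ipZr ip_lincomb mulrC.
Qed.

Lemma nsq_lincomb (a : 'I_n -> R[i]) : nsq (\sum_i a i *: e i) = \sum_i csq (a i).
Proof.
rewrite /nsq ip_lincomb2 Re_sum; apply: eq_bigr => i _.
by rewrite mul_conjc.
Qed.

Definition oproj v : V := \sum_i ip v (e i) *: e i.

Lemma oproj_ortho v j : ip (v - oproj v) (e j) = 0.
Proof. by rewrite ipBl ip_lincomb subrr. Qed.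

Lemma nsq_oproj v : nsq v = nsq (oproj v) + nsq (v - oproj v).
Proof.
have {1}-> : v = oproj v + (v - oproj v) by rewrite addrC subrK.
rewrite nsqD [X in _ + 2 * complex.Re X]ipC ip_sumr big1 ?rmorph0 ?mulr0 ?addr0 //.
by move=> i _; rewrite ipZr oproj_ortho mulr0.
Qed.

Lemma ipnorm_oproj v : N (oproj v) <= N v.
Proof. by rewrite ler_wsqrtr // -/(nsq _) -/(nsq v) (nsq_oproj v) lerDl nsq_ge0. Qed.

(** The new vector sits at the last index, where [unlift] returns [None] and [oapp] falls back on
    [v]. *)
Definition ext_family v : 'I_n.+1 -> V := fun i => oapp e v (unlift ord_max i).

Lemma ext_family_orthonormal v :
  (forall i, ip v (e i) = 0) -> nsq v = 1 -> Defs.orthonormal ip (ext_family v).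
Proof.
move=> ho h1 i j; rewrite /ext_family.
case: unliftP => [i'|] ->; case: unliftP => [j'|] -> /=.
- by rewrite he (inj_eq lift_inj).
- by rewrite ipC ho conjc0 eq_sym (negPf (neq_lift _ _)).
- by rewrite ho (negPf (neq_lift _ _)).
- by rewrite ipvv h1 eqxx.
Qed.

Lemma ext_familyP v (P : V -> Prop) :
  (forall i, P (e i)) -> P v -> forall i, P (ext_family v i).
Proof. by move=> h hv i; rewrite /ext_family; case: unliftP => [j|] _ /=. Qed.

End Orthonormal.

Lemma orthonormal0 (e : 'I_0 -> V) : Defs.orthonormal ip e.
Proof. by case. Qed.

(* More vectors than linear equations: the coefficient matrix has a nonzero left kernel. *)
Lemma lincomb_ortho m n (f : 'I_m -> V) (e : 'I_n -> V) :
  Defs.orthonormal ip f -> (n < m)%N ->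
  exists a : 'I_m -> R[i], nsq (\sum_i a i *: f i) != 0 /\
    forall j, ip (\sum_i a i *: f i) (e j) = 0.
Proof.
move=> hf nm; pose A : 'M[R[i]]_(m, n) := \matrix_(i, j) ip (f i) (e j).
have /rowV0Pn[r rA r0] : (kermx A != 0)%MS.
  rewrite -mxrank_eq0 mxrank_ker subn_eq0 -ltnNge.
  exact: leq_ltn_trans (rank_leq_col _) nm.
exists (fun i => r 0 i); split.
  apply: contra r0 => /eqP; rewrite nsq_lincomb // => h.
  apply/eqP/rowP => i; rewrite mxE; apply: csq_eq0.
  have /eqP := h; rewrite psumr_eq0 => [/allP/(_ i)|j _]; last exact: csq_ge0.
  by rewrite mem_index_enum => /(_ isT)/eqP.
move=> j; rewrite ip_suml.
have /sub_kermxP /rowP /(_ j) := rA; rewrite !mxE => h; rewrite -[RHS]h.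
by apply: eq_bigr => i _; rewrite ipZl mxE.
Qed.

Lemma normalize v : v != 0 -> nsq (((N v)^-1)%:C%C *: v) = 1.
Proof.
move=> v0; rewrite nsqZ csqC exprVn sqr_ipnorm mulVf //.
by rewrite gt_eqF // nsq_gt0.
Qed.

Lemma ipnorm_gt0 v : v != 0 -> 0 < N v.
Proof. by move=> v0; rewrite sqrtr_gt0 nsq_gt0. Qed.

Lemma ipnormZr (a : R) v : 0 <= a -> N (a%:C%C *: v) = a * N v.
Proof. by move=> a0; rewrite ipnormZ normc_csq csqC sqrtr_sqr ger0_norm. Qed.

End InnerProduct.

(** * Approximate kernels *)

Lemma exists_half_exp_lt (R : realType) (eps : R) : 0 < eps ->
  exists n : nat, forall m : nat, (n <= m)%N -> 2^-1 ^+ m < eps.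
Proof.
move=> e0; have [k hk] : exists k : nat, eps^-1 < k%:R.
  exists (Num.Def.archi_bound eps^-1); apply: archi_boundP.
  by rewrite invr_ge0 ltW.
exists k => m km; rewrite exprVn invf_plt ?posrE ?exprn_gt0 //.
apply: lt_le_trans hk _; rewrite -natrX ler_nat.
by apply: leq_trans km _; apply: ltnW; apply: ltn_expl.
Qed.

Section ApproximateKernel.
Variables (R : realType) (V : lmodType R[i]) (ip : V -> V -> R[i]).
Hypothesis hH : hilbert_space ip.
Local Notation N := (hnorm ip).
Let hip : is_inner_product ip := hH.1.

Record closed_subspace (P : V -> Prop) : Prop := ClosedSubspace {
  csub0 : P 0;
  csubP : forall (a : R[i]) x y, P x -> P y -> P (a *: x + y);
  csub_lim : forall l, (forall eps : R, 0 < eps -> exists2 v, P v & N (v - l) < eps) -> P l }.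

Variable P : V -> Prop.
Hypothesis hP : closed_subspace P.

Lemma csubZ a x : P x -> P (a *: x).
Proof. by move=> h; rewrite -[_ *: _]addr0; apply: (csubP hP) => //; exact: csub0. Qed.

Lemma csubB x y : P x -> P y -> P (x - y).
Proof. by move=> px py; rewrite addrC -scaleN1r; apply: (csubP hP). Qed.

Lemma csub_sum n (F : 'I_n -> V) : (forall i, P (F i)) -> P (\sum_i F i).
Proof.
move=> h; elim/big_ind: _ => [|x y px py|//]; first exact: csub0.
by rewrite -[x]scale1r; apply: (csubP hP).
Qed.

Variables (D : V -> V) (K : R).
Hypothesis D_lin : is_linear_op D.
Hypothesis K0 : 0 <= K.
Hypothesis D_bnd : forall v, N (D v) <= K * N v.

Lemma lin_op0 : D 0 = 0.
Proof.
have := D_lin 1 0 0; rewrite !scale1r addr0 => h.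
by apply: (addrI (D 0)); rewrite -h addr0.
Qed.

Lemma lin_opZ a x : D (a *: x) = a *: D x.
Proof. by have := D_lin a x 0; rewrite lin_op0 !addr0. Qed.

Lemma lin_opB x y : D (x - y) = D x - D y.
Proof.
have := D_lin (-1) y x; rewrite !scaleN1r => h.
by rewrite addrC h addrC.
Qed.

Lemma lin_op_lincomb n (a : 'I_n -> R[i]) (e : 'I_n -> V) :
  D (\sum_i a i *: e i) = \sum_i a i *: D (e i).
Proof.
have DD : {morph D : x y / x + y} by move=> x y; rewrite -{1}[x]scale1r D_lin scale1r.
by rewrite (big_morph D DD lin_op0); apply: eq_bigr => i _; exact: lin_opZ.
Qed.

Definition approx_kernel n (eps : R) := exists f : 'I_n -> V,
  Defs.orthonormal ip f /\ forall i, P (f i) /\ N (D (f i)) < eps.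

(* One step of the construction: since there is no family of size [n.+1] with
   residual [eps0], a vector with small residual is close to the span of any
   family of size [n] with small residual. *)
Lemma approx_kernel_step n (eps0 eta e e' : R) (f : 'I_n -> V) v :
  ~ approx_kernel n.+1 eps0 ->
  Defs.orthonormal ip f -> (forall i, P (f i) /\ N (D (f i)) < e') ->
  0 < eta -> eta < 1 -> 0 < eps0 -> (0 < n)%N ->
  e' <= e -> e = eps0 * eta / (4 * n%:R) ->
  P v -> N v <= 1 -> N (D v) <= n%:R * e ->
  [/\ P (oproj ip f v), N (oproj ip f v) <= 1,
      N (D (oproj ip f v)) <= n%:R * e' & N (v - oproj ip f v) < eta].
Proof.
move=> hno hf hf2 eta0 eta1 eps0_gt0 n0 e'e ee Pv Nv Dv.
have nR : 1 <= n%:R :> R by rewrite ler1n.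
have Pp : P (oproj ip f v).
  by apply: csub_sum => i; apply: csubZ; case: (hf2 i).
have Dp : N (D (oproj ip f v)) <= n%:R * e'.
  rewrite /oproj lin_op_lincomb; apply: le_trans (ipnorm_sum hip _) _.
  have -> : n%:R * e' = \sum_(i < n) e' by rewrite sumr_const card_ord mulr_natl.
  apply: ler_sum => i _; rewrite ipnormZ // -[leRHS]mul1r ler_pM ?normc_ge0 ?ipnorm_ge0 //.
    apply: le_trans (normc_ip_le hip _ _) _.
    by rewrite ipnorm_orthonormal // mulr1.
  by apply: ltW; case: (hf2 i).
split=> //; first exact: le_trans (ipnorm_oproj hip hf _) Nv.
(* If the remainder [g] had norm at least [eta], its normalization would extend [f] to a family of
   size [n.+1] with residuals below [eps0]. *)
rewrite ltNge; apply/negP => hg; apply: hno.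
set g := v - oproj ip f v in hg *.
have g0 : g != 0.
  apply/eqP => h; move: hg; rewrite h ipnormE nsq0 // sqrtr0; lra.
have Ng : 0 < N g by exact: ipnorm_gt0.
exists (ext_family f (((N g)^-1)%:C%C *: g)); split.
  apply: ext_family_orthonormal => //; last exact: normalize.
  by move=> i; rewrite ipZl // oproj_ortho // mulr0.
have en : e * (4 * n%:R) = eps0 * eta by rewrite ee; field; lra.
have e0 : 0 < e by rewrite ee divr_gt0 ?mulr_gt0 //; lra.
have e_lt : e < eps0 by nra.
apply: (@ext_familyP _ _ _ _ _ (fun w => P w /\ N (D w) < eps0)).
  by move=> i; case: (hf2 i) => ? ?; split=> //; lra.
split; first by apply: csubZ; apply: csubB.
rewrite lin_opZ ipnormZr ?invr_ge0 ?ipnorm_ge0 //.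
(* Both terms are at most [n * e], so the sum is at most [eps0 * eta / 2], below [eps0 * N g]; hence
   the factor 4 in [e]. *)
have Dg : N (D g) <= N (D v) + N (D (oproj ip f v)).
  by rewrite /g lin_opB; apply: (ipnormB hip).
rewrite mulrC ltr_pdivrMr //.
have : n%:R * e' <= n%:R * e by rewrite ler_wpM2l //; lra.
have : eps0 * eta <= eps0 * N g by rewrite ler_wpM2l // ltW.
nra.
Qed.

(** Take the largest [n], bounded by [B], such that families of size [n] exist at every precision.
    Projecting a vector successively onto families of ever smaller residual moves it by
    geometrically decreasing distances, and the limit is a nonzero kernel vector. *)
Lemma approx_kernel_exists (eps1 : R) (B : nat) : 0 < eps1 ->
  (forall n f, Defs.orthonormal ip f ->
     (forall i : 'I_n, P (f i) /\ N (D (f i)) < eps1) -> (n <= B)%N) ->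
  (forall eps : R, 0 < eps -> exists v, [/\ P v, nsq ip v = 1 & N (D v) < eps]) ->
  exists v, [/\ P v, v != 0 & D v = 0].
Proof.
move=> eps1_gt0 hB h1.
pose Q n := `[< forall eps : R, 0 < eps -> approx_kernel n eps >].
have Q1 : Q 1%N.
  apply/asboolP => eps e0; have [v [Pv v1 Dv]] := h1 _ e0.
  exists (fun=> v); split=> // i j; rewrite !ord1 eqxx ipvv // v1 //.
have QB n : Q n -> (n <= B)%N.
  by move=> /asboolP/(_ _ eps1_gt0)[f [hf1 hf2]]; apply: hB hf1 hf2.
have [n /asboolP Qn Qmax] := ex_maxnP (ex_intro _ 1%N Q1) QB.
have n0 : (0 < n)%N by exact: Qmax.
have [eps0 [e0 hno]] : exists eps0 : R, 0 < eps0 /\ ~ approx_kernel n.+1 eps0.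
  apply: contrapT => hn; suff : (n.+1 <= n)%N by rewrite ltnn.
  apply: Qmax; apply/asboolP => eps h; apply: contrapT => h'.
  by apply: hn; exists eps.
(* The moves add up to at most [2 * eta 0 = 1/2], so a sequence starting on the unit sphere stays
   away from 0. *)
pose eta k : R := 2^-1 ^+ k.+2.
pose eps k : R := eps0 * eta k / (4 * n%:R).
have nR : 1 <= n%:R :> R by rewrite ler1n.
have eta_gt0 k : 0 < eta k by rewrite exprn_gt0 // invr_gt0.
have etaS k : eta k.+1 = eta k / 2 by rewrite /eta exprSr.
have eta_lt1 k : eta k < 1 by rewrite /eta exprn_ilt1 ?invr_ge0 ?invf_lt1 ?ltr1n.
have n4 : 0 < 4 * n%:R :> R by rewrite mulr_gt0 // ltr0n.
have eps_gt0 k : 0 < eps k.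
  apply: divr_gt0; last exact: n4.
  by apply: mulr_gt0; [exact: e0|exact: eta_gt0].
have epsS k : eps k.+1 <= eps k.
  rewrite /eps ler_pM2r ?invr_gt0 //.
  by rewrite ler_pM2l // etaS; have := eta_gt0 k; lra.
have /choice[F hF] : forall k, exists f : 'I_n -> V,
    Defs.orthonormal ip f /\ forall i, P (f i) /\ N (D (f i)) < eps k.
  by move=> k; apply: Qn.
pose v := fix v k := if k is k'.+1 then oproj ip (F k) (v k') else F 0%N (Ordinal n0).
have inv k : [/\ P (v k), N (v k) <= 1 & N (D (v k)) <= n%:R * eps k].
  elim: k => [|k [Pk Nk Dk]].
    case: (hF 0%N) => o /(_ (Ordinal n0))[p d]; split=> //=.
      by rewrite ipnorm_orthonormal.
    have := eps_gt0 0%N; nra.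
  have [fo fr] := hF k.+1.
  by have [] := approx_kernel_step hno fo fr (eta_gt0 k) (eta_lt1 k) e0 n0
    (epsS k) erefl Pk Nk Dk.
have step k : N (v k - v k.+1) < eta k.
  have [fo fr] := hF k.+1; have [Pk Nk Dk] := inv k.
  by have [] := approx_kernel_step hno fo fr (eta_gt0 k) (eta_lt1 k) e0 n0
    (epsS k) erefl Pk Nk Dk.
have dist k m : N (v k - v (k + m)%N) <= 2 * eta k - 2 * eta (k + m)%N.
  elim: m => [|m IH]; first by rewrite addn0 !subrr ipnormE nsq0 // sqrtr0.
  have -> : v k - v (k + m.+1)%N = (v k - v (k + m)%N) + (v (k + m)%N - v (k + m).+1).
    by rewrite addrA subrK addnS.
  apply: le_trans (ipnormD hip _ _) _; rewrite addnS etaS.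
  have := step (k + m)%N; lra.
have dist2 k m : (k <= m)%N -> N (v k - v m) <= 2 * eta k.
  move=> /subnKC <-; apply: le_trans (dist _ _) _.
  by have := eta_gt0 (k + (m - k))%N; lra.
have etaE k : eta k = 2^-1 ^+ k / 4 by rewrite /eta !exprSr; field.
have [l hl] : exists l, forall e : R, 0 < e -> exists M : nat, forall m : nat,
    (M <= m)%N -> N (v m - l) < e.
  apply: hH.2 => e he; have [M hM] := exists_half_exp_lt he.
  exists M => m m' h h'; have := hM M (leqnn _).
  have -> : v m - v m' = (v M - v m') - (v M - v m).
    by rewrite opprB [RHS]addrC addrA subrK.
  have := dist2 _ _ h; have := dist2 _ _ h'.
  have := ipnormB hip (v M - v m') (v M - v m); rewrite etaE; lra.
exists l; split.
- apply: (csub_lim hP) => e he; have [M hM] := hl _ he.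
  by exists (v M); [case: (inv M)|exact: hM].
- have [M hM] : exists M : nat, forall m : nat, (M <= m)%N -> N (v m - l) < 4^-1.
    by apply: hl; rewrite invr_gt0.
  apply/eqP => l0; have := hM M (leqnn _); rewrite l0 subr0 => h.
  have := dist2 0%N M (leq0n _); rewrite /eta !exprS expr0 => h'.
  have : N (v 0%N) = 1.
    by rewrite /= (ipnorm_orthonormal (hF 0%N).1).
  have := ipnormD hip (v 0%N - v M) (v M); rewrite subrK; lra.
apply: (ipnorm0_eq0 hip); apply/eqP; rewrite eq_le ipnorm_ge0 andbT.
suff small (e : R) : 0 < e -> N (D l) <= e.
  by apply/ler_addgt0Pl => e he; rewrite addr0; exact: small.
move=> he.
(* Using [K + 1] keeps the divisor positive even when [K] is 0. *)
have K1 : 0 < 2 * (K + 1) by move: K0 => ?; lra.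
have [M hM] := hl _ (divr_gt0 he K1).
have [M' hM'] := @exists_half_exp_lt R (e / eps0) (divr_gt0 he e0).
pose m := maxn M M'.
have -> : D l = D (v m) - D (v m - l) by rewrite lin_opB opprB [RHS]addrC subrK.
apply: le_trans (ipnormB hip _ _) _.
have [_ _ Dm] := inv m.
have h := hM m (leq_maxl _ _); have h' := hM' m (leq_maxr _ _).
have b1 : n%:R * eps m < e / 2.
  rewrite /eps etaE; have -> : n%:R * (eps0 * (2^-1 ^+ m / 4) / (4 * n%:R))
    = eps0 * 2^-1 ^+ m / 16 by field; lra.
  by move: h'; rewrite ltr_pdivlMr // => h'; have := he; lra.
have b2 : N (D (v m - l)) <= e / 2.
  apply: le_trans (D_bnd _) _.
  have : N (v m - l) * (2 * (K + 1)) < e by rewrite -ltr_pdivlMr.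
  have := ipnorm_ge0 ip (v m - l); nra.
lra.
Qed.

End ApproximateKernel.

(** * Spectral subspaces of isometries *)

Section SpectralMaximum.
Variables (R : realType) (V : lmodType R[i]) (ip : V -> V -> R[i]).
Hypothesis hH : hilbert_space ip.
Local Notation N := (hnorm ip).
Let hip : is_inner_product ip := hH.1.
Variables (T : V -> V) (kappa : R[i]) (C : R).
Hypothesis T_lin : is_linear_op T.
Hypothesis T_iso : forall x y, ip (T x) (T y) = ip x y.
Hypothesis T_trace : forall n (f : 'I_n -> V), Defs.orthonormal ip f ->
  \sum_(i < n) Normc.normc (ip (T (f i) - kappa *: f i) (f i)) <= C.

Lemma nsq_iso v : nsq ip (T v) = nsq ip v.
Proof. by rewrite /nsq T_iso. Qed.

Lemma ipnorm_iso v : N (T v) = N v.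
Proof. by rewrite !ipnormE nsq_iso. Qed.

(** Each vector of the family contributes at least [d] to a sum bounded by [C], which leaves room
    for at most [C / d] of them. *)
Lemma trace_size_bound (d : R) : 0 < d -> exists B : nat,
  forall n (f : 'I_n -> V), Defs.orthonormal ip f ->
    (forall i, d <= complex.Re (ip (T (f i) - kappa *: f i) (f i))) -> (n <= B)%N.
Proof.
move=> d0; have C0 : 0 <= C.
  by apply: le_trans (T_trace (orthonormal0 ip (fun=> 0))); rewrite big_ord0.
exists (Num.Def.archi_bound (C / d)) => n f hf h.
rewrite -(ler_nat R); apply: ltW; apply: le_lt_trans (archi_boundP _).
  rewrite ler_pdivlMr //; apply: le_trans (T_trace hf).
  have -> : n%:R * d = \sum_(i < n) d by rewrite sumr_const card_ord mulr_natl.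
  apply: ler_sum => i _; apply: le_trans (h i) _.
  exact: le_trans (ler_norm _) (ler_Re_normc _).
by rewrite divr_ge0 // ltW.
Qed.

Lemma shift_lin (z : R[i]) : is_linear_op (fun v => T v - z *: v).
Proof.
move=> a x y; rewrite T_lin scalerDr !scalerA scalerBr scalerA (mulrC z a).
by rewrite opprD addrACA.
Qed.

Lemma shift_bounded (z : R[i]) v : N (T v - z *: v) <= (1 + Normc.normc z) * N v.
Proof.
apply: le_trans (ipnormB hip _ _) _.
by rewrite ipnorm_iso ipnormZ // mulrDl mul1r.
Qed.

Variable P : V -> Prop.
Hypothesis hP : closed_subspace ip P.
Hypothesis T_inv : forall v, P v -> P (T v).

(** On unit vectors almost annihilated by [T - z], the form of [T - kappa] has real part near
    [Re (z - kappa) > 0]. The trace bound thus limits the size of such orthonormal families, as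
    [approx_kernel_exists] requires; [d] is half the gap. *)
Lemma eigenvector_of_approx (z : R[i]) : complex.Re kappa < complex.Re z ->
  (forall eps : R, 0 < eps ->
     exists v, [/\ P v, nsq ip v = 1 & N (T v - z *: v) < eps]) ->
  exists v, [/\ P v, v != 0 & T v = z *: v].
Proof.
move=> kz h; pose d := (complex.Re z - complex.Re kappa) / 2.
have d0 : 0 < d by rewrite /d; lra.
have [B hB] := trace_size_bound d0.
have K0 : 0 <= 1 + Normc.normc z by rewrite addr_ge0 ?normc_ge0.
have [|v [Pv v0 /eqP]] := @approx_kernel_exists _ _ _ hH _ hP _ _ (shift_lin z) K0
  (shift_bounded z) d B d0 _ h.
  move=> n f hf hf2; apply: (hB _ _ hf) => i; have [_ r] := hf2 i.
  have -> : T (f i) - kappa *: f i = (T (f i) - z *: f i) + (z - kappa) *: f i.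
    by rewrite scalerBl addrA subrK.
  rewrite ipDl // ReD ipZl // (hf i i) eqxx mulr1 ReB.
  have := normc_ip_le hip (T (f i) - z *: f i) (f i).
  rewrite (ipnorm_orthonormal hf) mulr1 => le1.
  have := ler_Re_normc (ip (T (f i) - z *: f i) (f i)).
  rewrite ler_norml => /andP[le2 _].
  rewrite /d in r *; lra.
by rewrite subr_eq0 => /eqP Tv; exists v.
Qed.

Lemma form_bounded v : `|complex.Re (ip (T v) v)| <= nsq ip v.
Proof.
apply: le_trans (ler_Re_normc _) _; apply: le_trans (normc_ip_le hip _ _) _.
by rewrite ipnorm_iso -expr2 sqr_ipnorm.
Qed.

(* With M the supremum of the form, Cauchy-Schwarz for the nonnegative form
   q v = M |v|^2 - Re <T v, v> at T u and B u gives |B u|^2 <= 8 q u. *)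
Lemma quadratic_residual_le (M : R) u : M <= 1 ->
  (forall v, P v -> complex.Re (ip (T v) v) <= M * nsq ip v) -> P u ->
  nsq ip ((2 * M)%:C%C *: T u - T (T u) - u)
    <= 8 * (M * nsq ip u - complex.Re (ip (T u) u)).
Proof.
move=> M1 hM Pu; set b := _ - u.
have Pb : P b.
  apply: (csubB hP) => //; apply: (csubB hP); last by do 2!apply: T_inv.
  by apply: (csubZ hP); apply: T_inv.
(* Since [T] is isometric, the right-hand side is twice the cross term between [T u] and [b] of the
   form [q] below, which is why this combination [b] is chosen. *)
have nb : nsq ip b = 2 * M * complex.Re (ip (T u) b)
    - complex.Re (ip (T (T u)) b) - complex.Re (ip u b).
  by rewrite /nsq {1}/b !(ipBl hip) (ipZl hip) !ReB ReZ.
clearbody b; pose q v := M * nsq ip v - complex.Re (ip (T v) v).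
have q0 v : P v -> 0 <= q v by move=> Pv; rewrite /q subr_ge0 hM.
have qb : q b <= 2 * nsq ip b.
  have := form_bounded b; rewrite ler_norml /q => /andP[h _].
  have := nsq_ge0 hip b; nra.
have qT : q (T u) = q u by rewrite /q nsq_iso T_iso.
have h : (nsq ip b / 2) ^+ 2 <= q u * q b.
  apply: discriminant_le (q0 _ Pb) _ => t.
  have -> : q u + 2 * t * (nsq ip b / 2) + t ^+ 2 * q b = q (t%:C%C *: b + T u).
    rewrite -qT /q T_lin !nsqD // nsqZ // csqC !(ipDl hip) !(ipDr hip) !ReD !(ipZl hip) !(ipZr hip).
    rewrite !conjc_real !ReZ !T_iso nsq_iso.
    rewrite (Re_ipC hip (T u) b) (Re_ipC hip u b).
    have -> : 2 * t * (nsq ip b / 2) = t * nsq ip b by field.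
    rewrite {1}nb; ring.
  by apply: q0; apply: (csubP hP) => //; apply: T_inv.
have qu := q0 _ Pu; rewrite -/(q u).
have := nsq_ge0 hip b; rewrite le_eqVlt => /predU1P[<-|bp]; first lra.
have : q u * q b <= q u * (2 * nsq ip b) by rewrite ler_wpM2l.
move=> h2; rewrite -(ler_pM2r bp).
have : (nsq ip b / 2) ^+ 2 = nsq ip b * nsq ip b / 4 by field.
lra.
Qed.

(** If the form exceeded [c] somewhere, let [M > c] be its supremum on the unit sphere of [P].
    Near-maximizers are almost annihilated by [T^2 - 2 M T + 1], whose roots have real part [M]. One
    of them is an approximate eigenvalue, hence an eigenvalue by [eigenvector_of_approx], a
    contradiction. *)
Lemma form_le_of_eigenvalues (c : R) : complex.Re kappa < c ->
  (forall v (mu : R[i]), P v -> v != 0 -> T v = mu *: v -> complex.Re mu <= c) ->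
  forall v, P v -> complex.Re (ip (T v) v) <= c * nsq ip v.
Proof.
move=> kc hno v0 Pv0; rewrite leNgt; apply/negP => hv0.
have v0n0 : v0 != 0.
  apply/eqP => h; move: hv0; rewrite h nsq0 // mulr0 ip0r //= ltxx //.
pose S : set R := [set complex.Re (ip (T v) v) | v in [set v | P v /\ nsq ip v = 1]]%classic.
pose M := sup S.
have S1 : ubound S 1.
  move=> _ [v [_ h1] <-]; apply: le_trans (ler_norm _) _.
  by apply: le_trans (form_bounded _) _; rewrite h1.
have scale v : P v -> v != 0 -> S (complex.Re (ip (T v) v) / nsq ip v).
  move=> Pv vn0; exists (((N v)^-1)%:C%C *: v).
    by split; [exact: (csubZ hP)|exact: normalize].
  rewrite (lin_opZ T_lin) !(ipZl hip) !(ipZr hip) conjc_real !ReZ.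
  rewrite mulrA -expr2 exprVn (sqr_ipnorm hip) mulrC //.
have hasS : has_sup S by split; [eexists; exact: scale Pv0 v0n0|exists 1].
have cM : c < M.
  apply: lt_le_trans (ub_le_sup hasS.2 (scale _ Pv0 v0n0)).
  by rewrite ltr_pdivlMr // nsq_gt0.
have M1 : M <= 1 by apply: (ge_sup hasS.1).
have M1' : -1 <= M.
  have [v [Pv v1]] : exists v, P v /\ nsq ip v = 1.
    by case: hasS => -[_ [v [? ?] _]] _; exists v.
  have := form_bounded v; rewrite v1 ler_norml => /andP[h _].
  by apply: le_trans h (ub_le_sup hasS.2 _); exists v.
have hM v : P v -> complex.Re (ip (T v) v) <= M * nsq ip v.
  move=> Pv; have [->|vn0] := eqVneq v 0; first by rewrite ip0r // nsq0 // mulr0.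
  rewrite -ler_pdivrMr ?nsq_gt0 //; exact: (ub_le_sup hasS.2 (scale _ Pv vn0)).
(* [z] and [z'] are the roots of [X^2 - 2 M X + 1]; the bounds [-1 <= M <= 1] keep the square root
   genuine. *)
pose z : R[i] := (M +i* Num.sqrt (1 - M ^+ 2))%C.
pose z' := conjc z.
have zz : z + z' = (2 * M)%:C%C.
  by apply/eqP; rewrite eq_complex /= subrr eqxx andbT; apply/eqP; ring.
have zz' : z * z' = 1.
  rewrite mul_conjc /csq /= sqr_sqrtr; last by nra.
  by rewrite addrC subrK.
have approx (eps : R) : 0 < eps -> exists u, [/\ P u, nsq ip u = 1 &
   N (T (T u - z' *: u) - z *: (T u - z' *: u)) < eps].
  move=> e0; have e1 : 0 < eps ^+ 2 / 8 by rewrite divr_gt0 // exprn_gt0.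
  have [_ [u [Pu u1] <-] hu] := sup_adherent e1 hasS.
  exists u; split => //.
  have -> : T (T u - z' *: u) - z *: (T u - z' *: u)
      = - ((2 * M)%:C%C *: T u - T (T u) - u).
    rewrite (lin_opB T_lin) (lin_opZ T_lin) scalerBr scalerA zz' scale1r -zz scalerDl.
    by rewrite !opprD !opprK addrA; congr (_ + _); rewrite [RHS]addrC addrA addrAC.
  rewrite ipnormN // ipnormE -(ger0_norm (ltW e0)) -sqrtr_sqr.
  rewrite ltr_sqrt ?exprn_gt0 //.
  apply: le_lt_trans (quadratic_residual_le M1 hM Pu) _.
  by rewrite u1 mulr1; rewrite -/M in hu; lra.
have no (w : R[i]) : complex.Re w = M -> ~ (forall eps : R, 0 < eps ->
     exists v, [/\ P v, nsq ip v = 1 & N (T v - w *: v) < eps]).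
  move=> wM h; have [|v [Pv vn0 Tv]] := eigenvector_of_approx _ h.
    by rewrite wM (lt_trans kc cM).
  by have := hno _ _ Pv vn0 Tv; rewrite wM leNgt cM.
(* If [z'] fails at tolerance [eps], then [w = (T - z') u] has norm at least [eps], and the
   normalized [w] is an approximate eigenvector for [z]. The tolerance [eps' * eps] absorbs the
   division by [N w]. *)
apply: (no z') => // eps e0; apply: contrapT => hn.
apply: (no z) => // eps' e'0.
have [u [Pu u1 hu]] := approx _ (mulr_gt0 e'0 e0).
set w := T u - z' *: u in hu.
have Pw : P w by apply: (csubB hP); [exact: T_inv|exact: (csubZ hP)].
have ew : eps <= N w by rewrite leNgt; apply/negP => h; apply: hn; exists u.
have w0 : w != 0.
  by apply/eqP => h; move: ew; rewrite h ipnormE nsq0 // sqrtr0 leNgt e0.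
exists (((N w)^-1)%:C%C *: w); split; [exact: (csubZ hP)|exact: normalize|].
rewrite (lin_opZ (shift_lin z)) ipnormZr ?invr_ge0 ?ipnorm_ge0 // mulrC.
rewrite ltr_pdivrMr ?ipnorm_gt0 //; apply: lt_le_trans hu _.
by rewrite ler_wpM2l // ltW.
Qed.

End SpectralMaximum.

(** * Finite-dimensional spectral subspaces of a half-plane *)

Section SpectralSubspace.
Variables (R : realType) (V : lmodType R[i]) (ip : V -> V -> R[i]).
Hypothesis hH : hilbert_space ip.
Local Notation N := (hnorm ip).
Let hip : is_inner_product ip := hH.1.
Variables (T : V -> V) (kappa : R[i]) (C : R).
Hypothesis T_lin : is_linear_op T.
Hypothesis T_iso : forall x y, ip (T x) (T y) = ip x y.
Hypothesis T_trace : forall n (f : 'I_n -> V), Defs.orthonormal ip f ->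
  \sum_(i < n) Normc.normc (ip (T (f i) - kappa *: f i) (f i)) <= C.

Lemma closed_complement n (e : 'I_n -> V) :
  closed_subspace ip (fun v => forall i, ip v (e i) = 0).
Proof.
split=> [i|a x y hx hy i|l hl i]; first exact: ip0l.
  by rewrite ipDl // ipZl // hx hy mulr0 addr0.
have small (eps : R) : 0 < eps -> Normc.normc (ip l (e i)) <= eps.
  move=> e0; have e1 : 0 < N (e i) + 1 by rewrite ltr_wpDl ?ipnorm_ge0.
  have [v hv hvl] := hl _ (divr_gt0 e0 e1).
  have -> : ip l (e i) = ip (l - v) (e i) by rewrite ipBl // hv subr0.
  apply: le_trans (normc_ip_le hip _ _) _; rewrite ipnormC //.
  move: hvl; rewrite ltr_pdivlMr // => h.
  have := ipnorm_ge0 ip (v - l); have := ipnorm_ge0 ip (e i); nra.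
apply: Normc.eq0_normc; apply/eqP; rewrite eq_le normc_ge0 andbT.
by apply/ler_addgt0Pl => eps e0; rewrite addr0; exact: small.
Qed.

Lemma csq_eigenvalue v (mu : R[i]) : v != 0 -> T v = mu *: v -> csq mu = 1.
Proof.
move=> v0 Tv; have := nsq_iso T_iso v; rewrite Tv nsqZ // => h.
by apply: (mulIf (lt0r_neq0 (nsq_gt0 hip v0))); rewrite h mul1r.
Qed.

(** [T v] is orthogonal to [T (e i) = mu i *: e i] because [T] preserves inner products, and [mu i]
    is nonzero since it has modulus 1. *)
Lemma complement_invariant n (e : 'I_n -> V) (mu : 'I_n -> R[i]) :
  (forall i, T (e i) = mu i *: e i) -> (forall i, e i != 0) ->
  forall v, (forall i, ip v (e i) = 0) -> forall i, ip (T v) (e i) = 0.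
Proof.
move=> he e0 v hv i; have := T_iso v (e i); rewrite hv he ipZr // => /eqP.
rewrite mulf_eq0 conjc_eq0 => /orP[/eqP m0|/eqP //].
have := csq_eigenvalue (e0 i) (he i).
by rewrite m0 /csq /= expr0n addr0 => /eqP; rewrite eq_sym oner_eq0.
Qed.

(** By the trace bound there is a maximal orthonormal family of eigenvectors with real part above
    [c]. Its complement is closed and invariant; a further such eigenvector there would extend the
    family, so [form_le_of_eigenvalues] applies. *)
Lemma spectral_subspace (c : R) : complex.Re kappa < c ->
  exists n (e : 'I_n -> V) (mu : 'I_n -> R[i]),
  [/\ Defs.orthonormal ip e,
      forall i, T (e i) = mu i *: e i /\ c < complex.Re (mu i) &
      forall v, (forall i, ip v (e i) = 0) ->
        complex.Re (ip (T v) v) <= c * nsq ip v].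
Proof.
move=> kc.
pose Q n := `[< exists e : 'I_n -> V, Defs.orthonormal ip e /\
   forall i, exists mu : R[i], T (e i) = mu *: e i /\ c < complex.Re mu >].
have Q0 : Q 0%N by apply/asboolP; exists (fun=> 0); split; case.
have [|B hB] := @trace_size_bound _ _ _ _ _ _ T_trace (c - complex.Re kappa).
  by rewrite subr_gt0.
have QB n : Q n -> (n <= B)%N.
  move=> /asboolP[e [oe he]]; apply: (hB _ _ oe) => i; have [mu [-> h]] := he i.
  rewrite -scalerBl ipZl // (oe i i) eqxx mulr1 ReB; lra.
have [n /asboolP[e [oe he]] Qmax] := ex_maxnP (ex_intro _ 0%N Q0) QB.
have /choice[mu hmu] := he.
exists n, e, mu; split=> //.
have en0 i : e i != 0.
  apply/eqP => h; have := nsq_orthonormal oe i; rewrite h nsq0 // => /eqP.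
  by rewrite eq_sym oner_eq0.
apply: (form_le_of_eigenvalues hH T_lin T_iso T_trace (closed_complement e)) => //.
  exact: (complement_invariant (fun i => (hmu i).1) en0).
move=> v w hv v0 Tv; rewrite leNgt; apply/negP => cw.
suff : (n.+1 <= n)%N by rewrite ltnn.
apply: Qmax; apply/asboolP.
exists (ext_family e (((N v)^-1)%:C%C *: v)); split.
  apply: ext_family_orthonormal => //; last exact: normalize.
  by move=> i; rewrite ipZl // hv mulr0.
apply: (@ext_familyP _ _ _ _ _
  (fun u => exists mu : R[i], T u = mu *: u /\ c < complex.Re mu)) => //.
exists w; split=> //.
by rewrite (lin_opZ T_lin) Tv !scalerA mulrC.
Qed.

End SpectralSubspace.

(** * Arcs of the unit circle *)

Section UnitCircle.
Variable R : realType.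
Implicit Types s t a b : R.

Lemma expiD s t : expi (s + t) = expi s * expi t.
Proof.
by apply/eqP; rewrite eq_complex /= cosD sinD eqxx addrC eqxx.
Qed.

Lemma expi0 : expi (0 : R) = 1.
Proof. by rewrite /expi cos0 sin0. Qed.

Lemma csq_expi t : csq (expi t) = 1.
Proof. exact: cos2Dsin2. Qed.

Lemma normc_expi t : Normc.normc (expi t) = 1.
Proof. by rewrite normc_csq csq_expi sqrtr1. Qed.

Lemma expiD2pi t : expi (t + 2 * pi) = expi t.
Proof. by rewrite /expi mulr_natl cosD2pi sinD2pi. Qed.

Lemma cos2piB t : cos (2 * pi - t) = cos t.
Proof. by rewrite mulr_natl addrC cosD2pi cosN. Qed.

Lemma expiNK t : expi t * expi (- t) = 1.
Proof. by rewrite -expiD subrr expi0. Qed.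

Lemma conjc_expi t : conjc (expi t) = expi (- t).
Proof. by rewrite /expi cosN sinN. Qed.

Lemma expi_surj (z : R[i]) : csq z = 1 ->
  exists s : R, 0 <= s < 2 * pi /\ expi s = z.
Proof.
case: z => x y; rewrite /csq /= => h.
have x1 : -1 <= x <= 1.
  by rewrite -ler_norml -(@expr_le1 _ 2) ?normr_ge0 // real_normK ?num_real // -h lerDl sqr_ge0.
have hc : cos (acos x) = x by apply: acosK; rewrite in_itv.
have hs : sin (acos x) = `|y|.
  by rewrite sin_acos // -sqrtr_sqr; congr Num.sqrt; rewrite -h addrC addKr.
have p0 := acos_ge0 x1; have ppi := acos_lepi x1; have pi0 := pi_gt0 R.
have [y0|y0] := leP 0 y.
  exists (acos x); split; first by apply/andP; split; lra.
  by rewrite /expi hc hs ger0_norm.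
exists (2 * pi - acos x); split.
  have : 0 < acos x.
    rewrite lt_neqAle p0 andbT eq_sym; apply/eqP => e; move: hs.
    by rewrite e sin0 => /esym/eqP; rewrite normr_eq0 lt_eqF.
  by move=> ?; apply/andP; split; lra.
by rewrite addrC expiD2pi /expi cosN sinN hc hs ltr0_norm // opprK.
Qed.

(* On [0, 2 pi[ the distance to the midpoint of the arc stays below 2 pi - (b-a)/2,
   so comparing cosines amounts to comparing distances. *)
Lemma cos_arc a b s : 0 < a -> a < b -> b < 2 * pi -> 0 <= s < 2 * pi ->
  (cos ((b - a) / 2) < cos (s - (a + b) / 2)) = (a < s < b).
Proof.
move=> a0 ab b2 /andP[s0 s2].
rewrite -[cos (s - _)]cos_norm; set d := `|_|; set h := (b - a) / 2.
have -> : (a < s < b) = (d < h).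
  by rewrite /d /h ltr_norml; congr (_ && _); apply/idP/idP; lra.
have h0 : 0 < h by rewrite /h; lra.
have hpi : h < pi by rewrite /h; lra.
have d0 : 0 <= d by exact: normr_ge0.
have dh : d < 2 * pi - h.
  by rewrite /d /h ltr_norml; apply/andP; split; lra.
have [dpi|dpi] := leP d pi.
  by rewrite ltr_cos // in_itv /=; apply/andP; split; lra.
rewrite -(cos2piB d).
rewrite ltr_cos ?in_itv /=; try by apply/andP; split; lra.
by apply/idP/idP; lra.
Qed.

(** The angle 0 is outside the half-plane that cuts out the arc. After rotation by the midpoint this
    is the hypothesis on [kappa] in [spectral_subspace]. *)
Lemma cos_arc_lt0 a b : 0 < a -> a < b -> b < 2 * pi ->
  cos (- ((a + b) / 2)) < cos ((b - a) / 2).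
Proof.
move=> a0 ab b2; rewrite cosN; have [h|h] := leP ((a + b) / 2) pi.
  by rewrite ltr_cos ?in_itv /=; [lra|apply/andP; split; lra..].
rewrite -(cos2piB ((a + b) / 2)).
by rewrite ltr_cos ?in_itv /=; [lra|apply/andP; split; lra..].
Qed.

Lemma expi_inj s t : 0 <= s < 2 * pi -> 0 <= t < 2 * pi -> expi s = expi t -> s = t.
Proof.
move=> /andP[s0 s2] /andP[t0 t2] /eqP; rewrite eq_complex /= => /andP[/eqP hc /eqP hs].
have : cos (s - t) = 1 by rewrite cosB hc hs -!expr2 cos2Dsin2.
rewrite -cos_norm => h; have n0 : 0 <= `|s - t| by exact: normr_ge0.
have n2 : `|s - t| < 2 * pi by rewrite ltr_norml; apply/andP; split; lra.
apply/eqP; rewrite -subr_eq0 -normr_eq0; apply/eqP.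
have pi0 := pi_gt0 R.
have [dpi|dpi] := leP `|s - t| pi.
  apply: (@cos_inj R); rewrite ?in_itv /= ?lexx ?cos0 ?h //; apply/andP; split; lra.
have e : cos (2 * pi - `|s - t|) = cos 0 by rewrite cos2piB h cos0.
suff : 2 * pi - `|s - t| = 0 by lra.
apply: (@cos_inj R) e; rewrite in_itv /=; apply/andP; split; lra.
Qed.

Lemma expi_eq1 s : 0 <= s < 2 * pi -> expi s = 1 -> s = 0.
Proof.
by move=> hs; rewrite -expi0; apply: expi_inj; rewrite // lexx mulr_gt0 ?pi_gt0.
Qed.

End UnitCircle.

(** * Eigenvalues in an arc *)

Lemma finite_gap (R : realType) (L : seq R) (p : R) : p \notin L ->
  exists2 eta : R, 0 < eta & forall s, s \in L -> eta <= `|s - p|.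
Proof.
elim: L => [|x L IH]; first by exists 1.
rewrite inE negb_or => /andP[px /IH[eta eta0 h]].
exists (Num.min eta `|x - p|).
  by rewrite lt_min eta0 normr_gt0 subr_eq0 eq_sym px.
move=> s; rewrite inE => /predU1P[->|/h hs]; rewrite ge_min ?lexx ?orbT //.
by rewrite hs.
Qed.

Lemma eig_mult_unique (R : realType) (V : lmodType R[i]) (ip : V -> V -> R[i])
    T lam m n : eig_mult ip T lam m -> eig_mult ip T lam n -> m = n.
Proof.
move=> [[e [oe he]] hm] [[f [of_ hf]] hn]; apply/eqP; rewrite eqn_leq.
by rewrite (hn _ _ oe he) (hm _ _ of_ hf).
Qed.

Section UnitaryArcs.
Variables (R : realType) (V : lmodType R[i]) (ip : V -> V -> R[i]).
Hypothesis hH : hilbert_space ip.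
Let hip : is_inner_product ip := hH.1.

(** The rotation by minus the midpoint makes the arc []a, b[] symmetric about 1, where it consists
    of the points of the circle with real part above [cos ((b - a) / 2)]. *)
Definition arc_form (a b : R) (T : V -> V) v : R :=
  complex.Re (expi (- ((a + b) / 2)) * ip (T v) v).

(** [spectral_subspace] is applied to the rotated operator [W], with [kappa = w] the rotated 1; the
    trace bound carries over because [W - w = w (T - 1)]. *)
Lemma arc_family (T : V -> V) (a b : R) : in_U1 ip T ->
  0 < a -> a < b -> b < 2 * pi ->
  exists n (e : 'I_n -> V) (s : 'I_n -> R),
  [/\ Defs.orthonormal ip e,
      forall i, T (e i) = expi (s i) *: e i /\ a < s i < b &
      forall v, (forall i, ip v (e i) = 0) ->
        arc_form a b T v <= cos ((b - a) / 2) * nsq ip v].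
Proof.
move=> [T_lin _ T_iso T_tr] a0 ab b2.
pose w := expi (- ((a + b) / 2)); pose W v := w *: T v.
have W_lin : is_linear_op W.
  by move=> c x y; rewrite /W T_lin scalerDr !scalerA mulrC.
have W_iso x y : ip (W x) (W y) = ip x y.
  by rewrite /W ipZl // ipZr // mulrA mul_conjc csq_expi mul1r T_iso.
pose C := fine (trace_norm ip (fun v => T v - v)).
have W_tr n (f : 'I_n -> V) : Defs.orthonormal ip f ->
    \sum_(i < n) Normc.normc (ip (W (f i) - w *: f i) (f i)) <= C.
  move=> hf; have -> : \sum_(i < n) Normc.normc (ip (W (f i) - w *: f i) (f i))
      = \sum_(i < n) Normc.normc (ip (T (f i) - f i) (f i)).
    apply: eq_bigr => i _; rewrite /W -scalerBr ipZl // Normc.normcM normc_expi.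
    by rewrite mul1r.
  have : ((\sum_(i < n) Normc.normc (ip (T (f i) - f i) (f i)))%:E
     <= trace_norm ip (fun v => (T v - v)%R))%E.
    by apply: ereal_sup_ubound; exists n, f, f.
  by rewrite /C; case: (trace_norm _ _) T_tr.
have [|n [e [mu [oe he hv]]]] := spectral_subspace hH W_lin W_iso W_tr
  (c := cos ((b - a) / 2)); first exact: cos_arc_lt0.
have /choice[s hs] : forall i, exists s : R, T (e i) = expi s *: e i /\ a < s < b.
  move=> i; have [We mui] := he i.
  have e0 : e i != 0.
    by apply/eqP => h; have := nsq_orthonormal oe i; rewrite h nsq0 // => /eqP;
       rewrite eq_sym oner_eq0.
  have Te : T (e i) = (expi ((a + b) / 2) * mu i) *: e i.
    by rewrite -scalerA -We /W scalerA expiNK scale1r.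
  have [s [s2 es]] := expi_surj (csq_eigenvalue hH T_iso e0 Te).
  exists s; split; first by rewrite es.
  rewrite -cos_arc //.
  have -> : cos (s - (a + b) / 2) = complex.Re (expi (s - (a + b) / 2)) by [].
  rewrite expiD es -mulrA (mulrC (mu i)) mulrA expiNK mul1r //.
exists n, e, s; split=> // v /hv; rewrite /W ipZl //.
Qed.

(* Vectors with the same eigenangle as [s0] orthogonal to the [e i] with that angle are
   orthogonal to all [e i], where the form is too small for an eigenvector in the arc. *)
Lemma arc_family_mult (T : V -> V) (a b : R) n (e : 'I_n -> V) (s : 'I_n -> R) :
  in_U1 ip T -> 0 < a -> a < b -> b < 2 * pi ->
  Defs.orthonormal ip e ->
  (forall i, T (e i) = expi (s i) *: e i /\ a < s i < b) ->
  (forall v, (forall i, ip v (e i) = 0) ->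
     arc_form a b T v <= cos ((b - a) / 2) * nsq ip v) ->
  forall s0, a < s0 < b -> eig_mult ip T (expi s0) #|[set i | s i == s0]|.
Proof.
move=> [T_lin _ T_iso _] a0 ab b2 oe he hv s0 hs0; set A := [set i | _].
have s_in t : a < t < b -> 0 <= t < 2 * pi by move=> /andP[? ?]; apply/andP; split; lra.
split.
  exists (fun k : 'I_#|A| => e (enum_val k)); split.
    by move=> i j; rewrite oe (inj_eq enum_val_inj).
  move=> k; have [-> _] := he (enum_val k).
  by have := enum_valP k; rewrite inE => /eqP ->.
move=> m f of_ hf; rewrite leqNgt; apply/negP => mA.
have [c [u0 hu]] := lincomb_ortho hip (fun k : 'I_#|A| => e (enum_val k)) of_ mA.
set u := \sum_i _ in u0 hu.
have Tu : T u = expi s0 *: u.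
  rewrite /u (lin_op_lincomb T_lin) scaler_sumr; apply: eq_bigr => i _.
  by rewrite hf !scalerA mulrC.
(* For [i] outside [A] the eigenvalues of [u] and [e i] differ, and an isometry has orthogonal
   eigenvectors for distinct eigenvalues. *)
have ue i : ip u (e i) = 0.
  have [iA|] := boolP (i \in A); first by rewrite -(enum_rankK_in iA iA) hu.
  rewrite inE => ne; have := T_iso u (e i); have [-> hsi] := he i.
  rewrite Tu ipZl // ipZr // mulrA => /eqP; rewrite -subr_eq0 -{2}[ip u _]mul1r -mulrBl.
  rewrite mulf_eq0 subr_eq0 => /orP[/eqP h|/eqP //]; exfalso; move/negP: ne; apply.
  apply/eqP; apply: expi_inj; [exact: s_in|exact: s_in|].
  by rewrite -[LHS]mul1r -h conjc_expi -mulrA -expiD addNr expi0 mulr1.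
have := hv _ ue; rewrite /arc_form Tu ipZl // mulrA -expiD ipvv //.
rewrite mulrC ReZ mulrC ler_pM2r; last by rewrite lt_neqAle eq_sym u0 nsq_ge0.
have -> : complex.Re (expi (- ((a + b) / 2) + s0)) = cos (s0 - (a + b) / 2).
  by rewrite addrC.
by rewrite leNgt cos_arc ?s_in // hs0.
Qed.

(** A finite list with repetitions records angles and multiplicities together; its size is the total
    number of eigenvalues in the arc. *)
Definition arc_list (T : V -> V) (a b : R) (L : seq R) : Prop :=
  forall s, if a < s < b then eig_mult ip T (expi s) (count_mem s L)
            else s \notin L.

Lemma arc_list_perm T a b L L' : arc_list T a b L -> arc_list T a b L' -> perm_eq L L'.
Proof.
move=> h h'; apply/allP => s _ /=; have := h s; have := h' s.
case: ifP => _; last by move=> /count_memPn-> /count_memPn->.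
by move=> e e'; apply/eqP; apply: eig_mult_unique e' e.
Qed.

Lemma arc_family_list (T : V -> V) (a b : R) n (e : 'I_n -> V) (s : 'I_n -> R) :
  in_U1 ip T -> 0 < a -> a < b -> b < 2 * pi ->
  Defs.orthonormal ip e ->
  (forall i, T (e i) = expi (s i) *: e i /\ a < s i < b) ->
  (forall v, (forall i, ip v (e i) = 0) ->
     arc_form a b T v <= cos ((b - a) / 2) * nsq ip v) ->
  arc_list T a b [seq s i | i <- enum 'I_n].
Proof.
move=> hT a0 ab b2 oe he hv t; case: ifPn => ht.
  have -> : count_mem t [seq s i | i <- enum 'I_n] = #|[set i | s i == t]|.
    rewrite -sum1_count big_map big_enum_cond -sum1_card.
    by apply: eq_bigl => i; rewrite inE.
  exact: arc_family_mult ht.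
by apply: contra ht => /mapP[i _ ->]; case: (he i).
Qed.

Lemma arc_list_exists (T : V -> V) (a b : R) :
  in_U1 ip T -> 0 < a -> a < b -> b < 2 * pi -> exists L, arc_list T a b L.
Proof.
move=> hT a0 ab b2; have [n [e [s [oe he hv]]]] := arc_family hT a0 ab b2.
by eexists; exact: arc_family_list oe he hv.
Qed.

(** Only diagonal values are compared: this suffices for counting with quadratic forms and follows
    from closeness in trace norm. *)
Definition form_close (eps : R) (T T' : V -> V) : Prop :=
  forall v, nsq ip v = 1 -> Normc.normc (ip (T v - T' v) v) < eps.

Lemma form_close_le (eps : R) T T' a b v : is_linear_op T -> is_linear_op T' ->
  form_close eps T T' -> v != 0 ->
  `|arc_form a b T v - arc_form a b T' v| < eps * nsq ip v.
Proof.
move=> lT lT' hc v0; have := hc _ (normalize hip v0).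
rewrite (lin_opZ lT) (lin_opZ lT') -scalerBr ipZl // ipZr // conjc_real mulrA.
have -> : ((hnorm ip v)^-1%:C * (hnorm ip v)^-1%:C)%C = ((nsq ip v)^-1)%:C%C :> R[i].
  by rewrite -rmorphM -expr2 exprVn sqr_ipnorm.
have nv := nsq_gt0 hip v0.
rewrite Normc.normcM (normc_csq (_%:C)%C) csqC sqrtr_sqr ger0_norm; last first.
  by rewrite invr_ge0 ltW.
rewrite mulrC ltr_pdivrMr // => h; apply: le_lt_trans h.
rewrite /arc_form -ReB -mulrBr -ipBl //; apply: le_trans (ler_Re_normc _) _.
by rewrite Normc.normcM normc_expi mul1r.
Qed.

(* A vector in the span of the eigenvectors of [T'] orthogonal to the [e i] would have a
   form at least [c'] for [T'] but at most [c] for [T]. *)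
Lemma arc_size_le (T T' : V -> V) (a b c c' : R) n m (e : 'I_n -> V)
    (f : 'I_m -> V) (s : 'I_m -> R) :
  is_linear_op T -> is_linear_op T' -> form_close (c' - c) T T' ->
  (forall v, (forall i, ip v (e i) = 0) -> arc_form a b T v <= c * nsq ip v) ->
  Defs.orthonormal ip f ->
  (forall i, T' (f i) = expi (s i) *: f i /\ c' <= cos (s i - (a + b) / 2)) ->
  (m <= n)%N.
Proof.
move=> lT lT' hc hv of_ hf; rewrite leqNgt; apply/negP => nm.
have [r [u0 hu]] := lincomb_ortho hip e of_ nm.
have hT := hv _ hu.
have hT' : c' * nsq ip (\sum_i r i *: f i) <= arc_form a b T' (\sum_i r i *: f i).
  rewrite nsq_lincomb // mulr_sumr /arc_form (lin_op_lincomb lT').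
  have -> : \sum_i r i *: T' (f i) = \sum_i (r i * expi (s i)) *: f i.
    by apply: eq_bigr => i _; rewrite (hf i).1 scalerA.
  rewrite ip_lincomb2 // mulr_sumr Re_sum; apply: ler_sum => i _.
  have -> : expi (- ((a + b) / 2)) * (r i * expi (s i) * conjc (r i))
      = (csq (r i))%:C%C * expi (s i - (a + b) / 2).
    by rewrite -mul_conjc expiD; ring.
  rewrite ReZ mulrC ler_wpM2l ?csq_ge0 //; exact: (hf i).2.
have un0 : \sum_i r i *: f i != 0.
  by apply: contra u0 => /eqP->; rewrite nsq0.
have := form_close_le a b lT lT' hc un0; rewrite ltr_norml => /andP[h1 h2].
move: hT hT' h1 h2; lra.
Qed.

(** As neither endpoint is an eigenangle, for some small [eta] the eigenangles in the arc widened by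
    [eta] at both ends already lie in the arc narrowed by [eta]. This leaves room between
    [cos (h + eta)], [cos h] and [cos (h - eta)], and [arc_size_le] in both directions gives equal
    sizes. *)
Lemma arc_size_stable (T : V -> V) (a b : R) : in_U1 ip T ->
  0 < a -> a < b -> b < 2 * pi ->
  eig_mult ip T (expi a) 0 -> eig_mult ip T (expi b) 0 ->
  exists2 eps : R, 0 < eps & forall T' L L', in_U1 ip T' -> form_close eps T T' ->
    arc_list T a b L -> arc_list T' a b L' -> size L = size L'.
Proof.
move=> hT a0 ab b2 ha hb.
(* A larger arc supplies a finite list of all eigenangles near [a] and [b], from which the gaps are
   read. *)
have [|||L0 hL0] := @arc_list_exists T (a / 2) ((b + 2 * pi) / 2) hT; try by lra.
have notin t : a / 2 < t < (b + 2 * pi) / 2 -> eig_mult ip T (expi t) 0 -> t \notin L0.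
  move=> ht h0; have := hL0 t; rewrite ht => h1.
  by apply/count_memPn; apply: eig_mult_unique h1 h0.
have [|ea ea0 gapa] := @finite_gap _ L0 a.
  by apply: notin => //; apply/andP; split; lra.
have [|eb eb0 gapb] := @finite_gap _ L0 b.
  by apply: notin => //; apply/andP; split; lra.
have [eta [eta0 eta_a eta_b eta_1 [eta_2 eta_3]]] : exists eta : R,
    [/\ 0 < eta, eta < ea, eta < eb, eta < a / 2 & eta < (2 * pi - b) / 2 /\ eta < (b - a) / 2].
  exists (Num.min (Num.min ea eb) (Num.min (a / 2)
     (Num.min ((2 * pi - b) / 2) ((b - a) / 2))) / 2).
  set x := Num.min _ _.
  have x0 : 0 < x by rewrite !lt_min ea0 eb0 /=; apply/and3P; split; lra.
  have : x <= x by []. rewrite {2}/x !le_min => /and3P[/andP[? ?] ? /andP[? ?]].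
  by split; [lra..|split; lra].
have [|||n [e [s [oe he hv]]]] := @arc_family T (a - eta) (b + eta) hT; try lra.
(* The symmetric widening keeps the midpoint, so both arcs have the same [arc_form]. *)
have mid : (a - eta + (b + eta)) / 2 = (a + b) / 2 by lra.
have hL := arc_family_list hT _ _ _ oe he hv.
have s_in i : a + eta < s i < b - eta.
  have [_ hsi] := he i; have si0 : s i \in L0.
    have := hL0 (s i).
    have -> : a / 2 < s i < (b + 2 * pi) / 2 by move/andP: hsi => [? ?]; apply/andP; split; lra.
    have := hL _ _ _ (s i); rewrite hsi => h1 h2; rewrite -has_pred1 has_count.
    rewrite (eig_mult_unique h2 (h1 _ _ _)) -?has_count ?has_pred1 ?map_f ?mem_enum //; lra.
  have := gapa _ si0; have := gapb _ si0; move/andP: hsi => [? ?].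
  rewrite !ler_normr => /orP[?|?] /orP[?|?]; apply/andP; split; lra.
have hLab : arc_list T a b [seq s i | i <- enum 'I_n].
  move=> t; case: ifPn => ht.
    have := hL _ _ _ t; have -> : a - eta < t < b + eta by move/andP: ht => [? ?]; apply/andP; split; lra.
    by apply; lra.
  by apply: contra ht => /mapP[i _ ->]; have /andP[? ?] := s_in i; apply/andP; split; lra.
pose h := (b - a) / 2.
have c1 : cos (h + eta) < cos h.
  by rewrite ltr_cos ?in_itv /= /h; [lra|apply/andP; split; lra..].
have c2 : cos h < cos (h - eta).
  by rewrite ltr_cos ?in_itv /= /h; [lra|apply/andP; split; lra..].
exists (Num.min (cos h - cos (h + eta)) (cos (h - eta) - cos h)).
  by rewrite lt_min !subr_gt0 c1 c2.
move=> T' L L' hT' hc hL1 hL1'.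
rewrite (perm_size (arc_list_perm hL1 hLab)) size_map size_enum_ord.
have [m [f [s' [of_ hf hv']]]] := arc_family hT' a0 ab b2.
rewrite (perm_size (arc_list_perm hL1' (arc_family_list hT' a0 ab b2 of_ hf hv'))).
rewrite size_map size_enum_ord.
have [lT _ _ _] := hT; have [lT' _ _ _] := hT'.
apply/eqP; rewrite eqn_leq; apply/andP; split.
  apply: (@arc_size_le T' T a b (cos h) (cos (h - eta)) _ _ f e s) => //.
    move=> v v1; apply: lt_le_trans (_ : Num.min (cos h - cos (h + eta)) (cos (h - eta) - cos h) <= _).
      by have := hc v v1; rewrite -(opprB (T' v)) ipNl // normcN.
    by rewrite ge_min lexx orbT.
  move=> i; have [-> _] := he i; split=> //; apply/ltW.
  have -> : h - eta = ((b - eta) - (a + eta)) / 2 by rewrite /h; lra.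
  have -> : (a + b) / 2 = ((a + eta) + (b - eta)) / 2 by lra.
  rewrite cos_arc ?s_in //; try lra.
  by have /andP[? ?] := s_in i; apply/andP; split; lra.
apply: (@arc_size_le T T' a b (cos (h + eta)) (cos h) _ _ e f s') => //.
- move=> v v1; apply: lt_le_trans (hc v v1) _.
  by rewrite ge_min lexx.
- move=> v /hv; rewrite /arc_form mid.
  by have -> : (b + eta - (a - eta)) / 2 = h + eta by rewrite /h; lra.
- move=> i; have [-> hs] := hf i; split=> //; apply/ltW.
  by rewrite cos_arc //; move/andP: hs => [? ?]; apply/andP; split; lra.
Qed.

End UnitaryArcs.

(** * Continuous eigenangles in an arc *)

(** Each new point lies on one side of the midpoint of the current interval, which shrinks to a
    piece of the other side. *)
Lemma avoid_seq (R : realType) (L : seq R) (u v : R) : u < v ->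
  exists u' v', [/\ u < u', u' < v', v' < v & forall s, s \in L -> ~~ (u' <= s <= v')].
Proof.
move=> uv; elim: L => [|x L [u' [v' [h1 h2 h3 h4]]]].
  by exists (u + (v - u) / 3), (u + (v - u) / 3 * 2); split=> //; lra.
have [xl|xl] := leP x ((u' + v') / 2).
  exists ((u' + v') / 2 + (v' - u') / 4), v'; split=> //; try lra.
  move=> s; rewrite inE => /predU1P[->|/h4]; first by apply/negP => /andP[? _]; lra.
  by apply: contra => /andP[? ?]; apply/andP; split; lra.
exists u', ((u' + v') / 2); split=> //; try lra.
move=> s; rewrite inE => /predU1P[->|/h4]; first by apply/negP => /andP[_ ?]; lra.
by apply: contra => /andP[? ?]; apply/andP; split; lra.
Qed.

Lemma card_nat_interval k m : ([set n | (k <= n < k + m)%N]%classic #= `I_m)%card.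
Proof.
have -> : [set n | (k <= n < k + m)%N]%classic = (addn k @` `I_m)%classic.
  apply/seteqP; split=> [n /= /andP[kn nm]|_ /= [n nm <-]].
    by exists (n - k)%N; rewrite /= ?ltn_subLR ?subnKC.
  by rewrite leq_addr ltn_add2l.
by apply: inj_card_eq => x y _ _; apply: addnI.
Qed.

Section Multiplicity.
Variables (R : realType).
Implicit Types a b c s t u v y z : R.

Definition mult_seq (m : R -> R -> nat) (y a b : R) (L : seq R) :=
  forall s, count_mem s L = if a < s < b then m y s else 0%N.

(* [m y s] stands for the multiplicity of the eigenvalue [expi s] at time [y]. *)
Record locally_constant_mult (m : R -> R -> nat) : Prop := LocallyConstantMult {
  mult_fin : forall y a b, 0 < a -> a < b -> b < 2 * pi -> exists L, mult_seq m y a b L;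
  mult_stable : forall y a b, 0 < a -> a < b -> b < 2 * pi ->
    m y a = 0%N -> m y b = 0%N ->
    exists2 delta : R, 0 < delta & forall y' L L', `|y - y'| < delta ->
      mult_seq m y a b L -> mult_seq m y' a b L' -> size L = size L' }.

(** * Counting functions and ordered eigenangles in []0, alpha[] *)

Section OneSided.
Variable m : R -> R -> nat.
Hypothesis hm : locally_constant_mult m.

Lemma mult_seq_perm y a b L L' : mult_seq m y a b L -> mult_seq m y a b L' -> perm_eq L L'.
Proof. by move=> h h'; apply/allP => s _ /=; rewrite h h'. Qed.

(** Such lists agree up to permutation, so the size taken in [cnt] does not depend on the choice. By
    [mult_fin] the default [[::]] stands in for no missing list when [0 < a < b < 2 pi]. *)
Definition mseq y a b : seq R := xget [::] [set L | mult_seq m y a b L]%classic.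
Definition cnt y a b : nat := size (mseq y a b).

Lemma mseqP y a b : 0 < a -> a < b -> b < 2 * pi -> mult_seq m y a b (mseq y a b).
Proof.
move=> a0 ab b2; have [L hL] := mult_fin hm y a0 ab b2.
by have := @xgetPex _ [::] [set L | mult_seq m y a b L]%classic; apply; exists L.
Qed.

Lemma cntE y a b L : 0 < a -> a < b -> b < 2 * pi -> mult_seq m y a b L -> cnt y a b = size L.
Proof.
move=> a0 ab b2 hL; apply: perm_size; apply: mult_seq_perm hL; exact: mseqP.
Qed.

Lemma cnt_split y a c b : 0 < a -> a < c -> c < b -> b < 2 * pi ->
  cnt y a b = (cnt y a c + (m y c + cnt y c b))%N.
Proof.
move=> a0 ac cb b2.
rewrite (@cntE y a b (mseq y a c ++ nseq (m y c) c ++ mseq y c b)); [|lra..|].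
  by rewrite !size_cat size_nseq.
move=> s; rewrite !count_cat count_nseq (mseqP y a0 ac _) ?(mseqP y _ cb b2); [|lra..].
rewrite /= (eq_sym c s).
case: (ltgtP s c) => [sc|cs|->] /=; rewrite ?mul1n ?mul0n ?add0n ?addn0.
- by rewrite (lt_trans sc cb) !andbT ?addn0.
- by rewrite (lt_trans ac cs) /= ?andbF.
- by rewrite ac cb ?ltxx ?andbF /= ?addn0.
Qed.

Lemma cnt_mono y a a' b : 0 < a -> a <= a' -> a' < b -> b < 2 * pi ->
  (cnt y a' b <= cnt y a b)%N.
Proof.
move=> a0; rewrite le_eqVlt => /predU1P[->//|aa' a'b b2].
by rewrite (cnt_split y a0 aa' a'b b2) addnA leq_addl.
Qed.

Lemma cnt_right_gap y a b : 0 < a -> a < b -> b < 2 * pi ->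
  exists t, [/\ a < t, t < b & cnt y t b = cnt y a b].
Proof.
move=> a0 ab b2; have hL := mseqP y a0 ab b2.
have [|eta eta0 h] := @finite_gap _ (mseq y a b) a.
  by apply/count_memPn; rewrite hL ltxx.
pose t := a + Num.min eta (b - a) / 2.
have d0 : 0 < Num.min eta (b - a) by rewrite lt_min eta0 /=; lra.
have [d1 d2] : Num.min eta (b - a) <= eta /\ Num.min eta (b - a) <= b - a.
  by split; rewrite ge_min lexx ?orbT.
have t1 : a < t by rewrite /t; lra.
have t2 : t < b by rewrite /t; lra.
exists t; split=> //.
apply: cntE => //; first lra.
move=> s; rewrite hL.
case: ifPn => ab_s; case: ifPn => tb_s //.
  apply/eqP/negPn/negP => ms; move/negP: tb_s; apply.
  have : s \in mseq y a b by rewrite -has_pred1 has_count hL ab_s lt0n.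
  move=> /h; move/andP: ab_s => [? ?]; rewrite ger0_norm; last lra.
  by move=> ?; rewrite /t; apply/andP; split; lra.
exfalso; move/negP: ab_s; apply; move: tb_s; rewrite /t => /andP[? ?].
by apply/andP; split; lra.
Qed.

(** Only finitely many angles of positive multiplicity lie in []s / 2, s[]; with [t] above all of
    them, [s] is the only angle gained. *)
Lemma cnt_left_gap y s b : 0 < s -> s < b -> b < 2 * pi ->
  exists t, [/\ 0 < t, t < s & cnt y t b = (m y s + cnt y s b)%N].
Proof.
move=> s0 sb b2; have s2 : s / 2 < s by lra. have s20 : 0 < s / 2 by lra.
have sp : s < 2 * pi by lra.
have hL := mseqP y s20 s2 sp.
have [|eta eta0 h] := @finite_gap _ (mseq y (s / 2) s) s.
  by apply/count_memPn; rewrite hL ltxx andbF.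
pose d := Num.min eta (s / 2); pose t := s - d / 2.
have d0 : 0 < d by rewrite lt_min eta0 /=; lra.
have [d1 d2] : d <= eta /\ d <= s / 2 by split; rewrite ge_min lexx ?orbT.
have t0 : 0 < t by rewrite /t; lra.
have ts : t < s by rewrite /t; lra.
exists t; split=> //; rewrite (cnt_split y t0 ts sb b2) (@cntE y t s [::]) //.
move=> u; case: ifPn => //= /andP[tu us].
apply/esym/eqP/negPn/negP => mu.
have : u \in mseq y (s / 2) s.
  rewrite -has_pred1 has_count hL us andbT.
  have -> : s / 2 < u by rewrite /t in tu; lra.
  by rewrite lt0n.
move=> /h; rewrite ler0_norm; last lra.
by rewrite /t in tu; lra.
Qed.

Lemma mult_free y u v : 0 < u -> u < v -> v < 2 * pi ->
  exists p, [/\ u < p, p < v & m y p = 0%N].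
Proof.
move=> u0 uv v2; have hL := mseqP y u0 uv v2.
have [u' [v' [h1 h2 h3 h4]]] := avoid_seq (mseq y u v) uv.
exists u'; split=> //; first lra.
have : u' \notin mseq y u v.
  by apply/negP => /h4; rewrite lexx (ltW h2).
move=> /count_memPn; rewrite hL h1 /=.
by have -> : u' < v by lra.
Qed.

Variable alpha : R.
Hypotheses (alpha0 : 0 < alpha) (alpha2 : alpha < 2 * pi).

Lemma cnt_eventually0 y : exists t, [/\ 0 < t, t < alpha & cnt y t alpha = 0%N].
Proof.
have a0 := alpha0; have a2 := alpha2.
have h2 : alpha / 2 < alpha by lra. have h20 : 0 < alpha / 2 by lra.
have hL := mseqP y h20 h2 a2.
have [|eta eta0 h] := @finite_gap _ (mseq y (alpha / 2) alpha) alpha.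
  by apply/count_memPn; rewrite hL ltxx andbF.
pose d := Num.min eta (alpha / 2); pose t := alpha - d / 2.
have d0 : 0 < d by rewrite lt_min eta0 /=; lra.
have [d1 d2] : d <= eta /\ d <= alpha / 2 by split; rewrite ge_min lexx ?orbT.
have t0 : 0 < t by rewrite /t; lra.
have ts : t < alpha by rewrite /t; lra.
exists t; split=> //; rewrite (@cntE y t alpha [::]) //.
move=> u; case: ifPn => //= /andP[tu us].
apply/esym/eqP/negPn/negP => mu.
have : u \in mseq y (alpha / 2) alpha.
  rewrite -has_pred1 has_count hL us andbT.
  have -> : alpha / 2 < u by rewrite /t in tu; lra.
  by rewrite lt0n.
move=> /h; rewrite ler0_norm; last lra.
by rewrite /t in tu; lra.
Qed.

(* [angle n y] is the [n]-th largest angle of an eigenvalue in ]0, alpha[, counted with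
   multiplicity, or 0 if there are at most [n]; the element 0 makes the supremum exist. *)
Definition angle_set (n : nat) (y : R) : set R :=
  [set t | t = 0 \/ (0 < t < alpha /\ (n < cnt y t alpha)%N)]%classic.
Definition angle (n : nat) (y : R) : R := sup (angle_set n y).

Lemma angle_has_sup n y : has_sup (angle_set n y).
Proof.
split; first by exists 0; left.
by exists alpha => t [->|[/andP[_ /ltW]]//]; exact: ltW.
Qed.

Lemma angle_ge0 n y : 0 <= angle n y.
Proof. by apply: ub_le_sup; [exact: (angle_has_sup n y).2|left]. Qed.

(** This link between angles and counts yields both the cardinality and the continuity of angles.
    Strictness comes from [cnt_right_gap]: the count at [t] is still attained at a larger [t'],
    which belongs to [angle_set]. *)
Lemma angle_gt n y t : 0 < t -> t < alpha -> (t < angle n y) = (n < cnt y t alpha)%N.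
Proof.
move=> t0 ta; apply/idP/idP => [h|h].
  have e0 : 0 < angle n y - t by rewrite subr_gt0.
  have [t' [->|[/andP[t'0 t'a] hn]]] := sup_adherent e0 (angle_has_sup n y).
    rewrite -/(angle n y); lra.
  rewrite -/(angle n y) => tt'; apply: leq_trans hn _.
  by apply: cnt_mono => //; lra.
have [t' [tt' t'a e]] := cnt_right_gap y t0 ta alpha2.
apply: (lt_le_trans tt'); apply: ub_le_sup; first exact: (angle_has_sup n y).2.
by right; rewrite e h; split=> //; apply/andP; split; lra.
Qed.

Lemma angle_lt n y : angle n y < alpha.
Proof.
have [t [t0 ta e]] := cnt_eventually0 y; apply: (le_lt_trans _ ta).
by rewrite leNgt angle_gt // e.
Qed.

(** The count on []t, alpha[] drops by exactly [m y s] as [t] reaches [s] from below, so by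
    [angle_gt] these indices form an interval of that length. *)
Lemma angle_card y s : 0 < s -> s < alpha ->
  ([set n | angle n y = s]%classic #= `I_(m y s))%card.
Proof.
move=> s0 sa; have [t [t0 ts e]] := cnt_left_gap y s0 sa alpha2.
have ta : t < alpha by lra.
suff -> : [set n | angle n y = s]%classic
    = [set n | (cnt y s alpha <= n < cnt y s alpha + m y s)%N]%classic.
  exact: card_nat_interval.
apply/seteqP; split=> n /=.
  move=> h; rewrite [in X in _ && X]addnC -e -angle_gt // h ts andbT.
  by rewrite leqNgt -angle_gt // h ltxx.
rewrite [in X in _ && X]addnC -e -angle_gt // leqNgt -angle_gt // -leNgt => /andP[h1 h2].
apply/eqP; rewrite eq_le h1 /= leNgt; apply/negP => h3.
have [t' [t'0 t's e']] : exists t', [/\ 0 < t', angle n y < t' < s & cnt y t' alpha = cnt y t alpha].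
  exists ((angle n y + s) / 2); split; [lra|by apply/andP; split; lra|].
  have tt' : t < (angle n y + s) / 2 by lra.
  apply/eqP; rewrite eqn_leq cnt_mono ?(ltW tt') //=; last lra.
  rewrite e (@cnt_split y ((angle n y + s) / 2) s alpha) //; [by rewrite leq_addl|lra..].
move/andP: t's => [h4 h5]; move: h2; rewrite angle_gt // -e' -angle_gt //; lra.
Qed.

Lemma cnt_stable y t : 0 < t -> t < alpha -> m y t = 0%N -> m y alpha = 0%N ->
  exists2 delta : R, 0 < delta &
    forall z, `|y - z| < delta -> cnt z t alpha = cnt y t alpha.
Proof.
move=> t0 ta mt ma; have [d d0 h] := mult_stable hm t0 ta alpha2 mt ma.
exists d => // z /h/(_ (mseqP y t0 ta alpha2) (mseqP z t0 ta alpha2)).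
by rewrite /cnt => ->.
Qed.

(** Between a bound [t] and [angle n y] there is a point [p] of multiplicity 0 at time [y]. The
    count on []p, alpha[] is locally constant, and [angle_gt] transfers the comparison with [p] to
    nearby times. *)
Lemma angle_continuous n y : m y alpha = 0%N -> {for y, continuous (angle n)}.
Proof.
move=> ma; have a2 := alpha2.
have lower t : t < angle n y ->
    exists2 d : R, 0 < d & forall z, `|y - z| < d -> t < angle n z.
  move=> ht; have [tn|tp] := ltP t 0.
    by exists 1 => // z _; apply: lt_le_trans tn (angle_ge0 _ _).
  have al := angle_lt n y.
  have [|||p [p1 p2 mp]] := @mult_free y ((t + angle n y) / 2) (angle n y); [lra..|].
  have p0 : 0 < p by lra. have pa : p < alpha by lra.
  have [d d0 h] := cnt_stable p0 pa mp ma.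
  exists d => // z /h e; apply: (@lt_trans _ _ p); first lra.
  by rewrite angle_gt // e -angle_gt.
have upper t : angle n y < t ->
    exists2 d : R, 0 < d & forall z, `|y - z| < d -> angle n z < t.
  move=> ht; have [tn|tp] := leP alpha t.
    by exists 1 => // z _; apply: lt_le_trans (angle_lt _ _) tn.
  have a0 := angle_ge0 n y.
  have [|||p [p1 p2 mp]] := @mult_free y ((t + angle n y) / 2) t; [lra..|].
  have p0 : 0 < p by lra. have pa : p < alpha by lra.
  have [d d0 h] := cnt_stable p0 pa mp ma.
  exists d => // z /h e; apply: (le_lt_trans _ p2).
  by rewrite leNgt angle_gt // e -angle_gt // -leNgt; lra.
apply/cvgrPdist_lt => eps e0.
have [|d1 d10 h1] := lower (angle n y - eps); first by rewrite gtrBl.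
have [|d2 d20 h2] := upper (angle n y + eps); first by rewrite ltrDl.
apply/nbhs_ballP; exists (Num.min d1 d2); first by rewrite /= lt_min d10 d20.
move=> z; rewrite /ball /= lt_min => /andP[/h1 g1 /h2 g2].
by rewrite ltr_norml; apply/andP; split; lra.
Qed.

End OneSided.
End Multiplicity.

(** * Local enumerations and gluing *)

Section Clamp.
Variable R : realType.
Implicit Types a b x y : R.

(** Composition with it extends a function on [[a, b]] by constants, so that continuity can be
    handled on the whole line. *)
Definition clamp a b x : R := Num.max a (Num.min b x).

Lemma clamp_in a b x : a <= b -> a <= clamp a b x <= b.
Proof. by move=> ab; rewrite /clamp le_max lexx ge_max ab ge_min lexx. Qed.

Lemma clamp_id a b x : a <= x <= b -> clamp a b x = x.
Proof. by move=> /andP[ax xb]; rewrite /clamp (min_idPr xb) (max_idPr ax). Qed.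

Definition nonexpansive (g : R -> R) := forall x y, `|g x - g y| <= `|x - y|.

Lemma nonexpansive_max b : nonexpansive (Num.max b).
Proof.
move=> x y; have h1 := ler_norm (x - y).
have h3 : y - x <= `|x - y| by rewrite distrC ler_norm.
have h0 := normr_ge0 (x - y).
by rewrite ler_norml; apply/andP; case: (leP b x); case: (leP b y) => ? ?; split; lra.
Qed.

Lemma nonexpansive_min b : nonexpansive (Num.min b).
Proof.
move=> x y; have h1 := ler_norm (x - y).
have h3 : y - x <= `|x - y| by rewrite distrC ler_norm.
have h0 := normr_ge0 (x - y).
by rewrite ler_norml; apply/andP; case: (leP b x); case: (leP b y) => ? ?; split; lra.
Qed.

Lemma nonexpansive_clamp a b : nonexpansive (clamp a b).
Proof. by move=> x y; apply: le_trans (nonexpansive_max _ _ _) (nonexpansive_min _ _ _). Qed.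

Lemma continuous_nonexpansive (g : R -> R) : nonexpansive g -> continuous g.
Proof.
move=> hg x; apply/cvgrPdist_lt => eps e0; apply/nbhs_ballP; exists eps => //= y.
by rewrite /ball /=; apply: le_lt_trans.
Qed.

End Clamp.

Section Enumeration.
Variables (R : realType) (m : R -> R -> nat).
Hypothesis hm : locally_constant_mult m.
Implicit Types a b c s t y : R.

(** The infinite padding by the value 1 lets any two enumerations match at a common time. Continuity
    is required on the whole line, the values only on [[a, b]]. *)
Definition enumerates a b (theta : nat -> R -> R) : Prop :=
  (forall j, continuous (theta j)) /\
  forall y, a <= y <= b ->
    (forall s, 0 < s < 2 * pi ->
       ([set j | expi (theta j y) = expi s]%classic #= `I_(m y s))%card) /\
    infinite_set [set j | expi (theta j y) = 1]%classic.

Lemma reflectK s : 2 * pi - (2 * pi - s) = s.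
Proof. lra. Qed.

Lemma reflect_arc a b s : (2 * pi - b < s < 2 * pi - a) = (a < 2 * pi - s < b).
Proof. by apply/andP/andP => -[? ?]; split; lra. Qed.

(** Conjugation exchanges the two ends of []0, 2 pi[], so the construction for angles below [alpha]
    also serves those above it. *)
Lemma locally_constant_reflect : locally_constant_mult (fun y s => m y (2 * pi - s)).
Proof.
have refl y a b L : mult_seq (fun y s => m y (2 * pi - s)) y a b L ->
    mult_seq m y (2 * pi - b) (2 * pi - a) [seq 2 * pi - s | s <- L].
  move=> hL s; rewrite count_map.
  rewrite (@eq_count _ _ (pred1 (2 * pi - s))); last first.
    by move=> x /=; apply/eqP/eqP; lra.
  by rewrite hL reflectK reflect_arc.
split=> [y a b a0 ab b2|y a b a0 ab b2 ma mb].
  have [|||L hL] := @mult_fin _ _ hm y (2 * pi - b) (2 * pi - a); [lra..|].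
  exists [seq 2 * pi - s | s <- L] => s; rewrite count_map.
  rewrite (@eq_count _ _ (pred1 (2 * pi - s))); last first.
    by move=> x /=; apply/eqP/eqP; lra.
  by rewrite hL reflect_arc reflectK.
have [|||d d0 h] := mult_stable hm (y := y) (a := 2 * pi - b) (b := 2 * pi - a) _ _ _ mb ma;
  [lra..|].
exists d => // z L L' yz /refl hL /refl hL'.
by have := h _ _ _ yz hL hL'; rewrite !size_map.
Qed.

(** An interval [[u, v]] free of eigenangles at time [y] has count 0, which persists at nearby
    times; its midpoint then keeps multiplicity 0. *)
Lemma gap_exists y : exists alpha delta : R, [/\ 0 < alpha, alpha < 2 * pi, 0 < delta &
  forall z, `|y - z| < delta -> m z alpha = 0%N].
Proof.
have pi0 := pi_gt0 R.
have [|||L hL] := @mult_fin _ _ hm y (pi / 2) pi; [lra..|].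
have [|u [v [h1 h2 h3 h4]]] := @avoid_seq _ L (pi / 2) pi; first lra.
have mL s : u <= s <= v -> m y s = 0%N.
  move=> hs; have /negP/negP/count_memPn := contraTN (h4 s) hs; rewrite hL.
  by have -> : pi / 2 < s < pi by move/andP: hs => [? ?]; apply/andP; split; lra.
have u0 : 0 < u by lra. have v2 : v < 2 * pi by lra.
have mu : m y u = 0%N by apply: mL; rewrite lexx ltW.
have mv : m y v = 0%N by apply: mL; rewrite lexx ltW.
have [d d0 h] := mult_stable hm u0 h2 v2 mu mv.
exists ((u + v) / 2), d; split=> //; try lra.
move=> z yz; have [L' hL'] := mult_fin hm z u0 h2 v2.
have hnil : mult_seq m y u v [::].
  by move=> s; case: ifP => // /andP[/ltW us /ltW sv]; rewrite mL // us sv.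
have := h _ _ _ yz hnil hL' => /esym/size0nil e.
have := hL' ((u + v) / 2); rewrite e /=.
by have -> : u < (u + v) / 2 < v by apply/andP; split; lra.
Qed.

Lemma infinite_image_sub (g : nat -> nat) (A : set nat) : injective g ->
  (forall k, A (g k)) -> infinite_set A.
Proof.
move=> gi hA; apply/infiniteP; have hg : (g @` [set: nat] `<=` A)%classic by move=> _ [k _ <-].
apply: card_le_trans (subset_card_le hg).
by have := @inj_card_eq _ _ [set: nat]%classic g (fun k l _ _ => @gi k l); rewrite card_eq_le => /andP[].
Qed.

(** Three sequences are interleaved by the index modulo 3: the angles below [alpha], the negatives
    of the reflected angles for those above, and zeros for the infinite multiplicity of 1. *)
Lemma enumerates_local y : exists2 delta : R, 0 < delta &
  exists theta, enumerates (y - delta) (y + delta) theta.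
Proof.
have [alpha [d [a0 a2 d0 ha]]] := gap_exists y.
have a0' : 0 < 2 * pi - alpha by lra.
have a2' : 2 * pi - alpha < 2 * pi by lra.
have hm' := locally_constant_reflect.
pose m' z s := m z (2 * pi - s).
(* Times are clamped to radius [d / 2], where [alpha] is never an eigenangle, so that the angles
   become continuous on the whole line. *)
pose cl := clamp (y - d / 2) (y + d / 2).
have clin z : `|y - cl z| < d.
  have /andP[? ?] : y - d / 2 <= cl z <= y + d / 2 by apply: clamp_in; lra.
  by rewrite ltr_norml; apply/andP; split; lra.
have clc : continuous cl by exact/continuous_nonexpansive/nonexpansive_clamp.
pose thp k := angle m alpha k \o cl.
pose thm k := angle m' (2 * pi - alpha) k \o cl.
have cp k : continuous (thp k).
  by move=> z; apply: continuous_comp; [exact: clc|apply: angle_continuous => //; exact/ha/clin].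
have cm k : continuous (thm k).
  move=> z; apply: continuous_comp; first exact: clc.
  by apply: angle_continuous => //; rewrite /m' reflectK; exact/ha/clin.
pose theta j : R -> R := match (j %% 3)%N with
  | 0%N => thp (j %/ 3)%N | 1%N => fun z => - thm (j %/ 3)%N z | _ => fun=> 0 end.
have e0 k : theta (k * 3)%N = thp k by rewrite /theta modnMl mulnK.
have e1 k : theta (k * 3 + 1)%N = fun z => - thm k z.
  by rewrite /theta modnMDl divnMDl // addn0.
have e2 k : theta (k * 3 + 2)%N = fun=> 0 by rewrite /theta modnMDl.
have cases j : exists k, [\/ j = (k * 3)%N, j = (k * 3 + 1)%N | j = (k * 3 + 2)%N].
  exists (j %/ 3)%N; have := ltn_pmod j (isT : 0 < 3)%N; have := divn_eq j 3.
  case: (j %% 3)%N => [|[|[|//]]] h _; [apply: Or31|apply: Or32|apply: Or33].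
  - by rewrite {1}h addn0.
  - exact: h.
  - exact: h.
exists (d / 2); first lra.
exists theta; split.
  move=> j; have [k [->|->|->]] := cases j; rewrite ?e0 ?e1 ?e2 //.
  - by move=> z; apply: continuousN; exact: cm.
  - by move=> z; exact: cst_continuous.
move=> z hz; have clz : cl z = z by exact: clamp_id.
have mza : m z alpha = 0%N by rewrite -clz; exact/ha/clin.
have pge k : 0 <= thp k z by exact: angle_ge0.
have mge k : 0 <= thm k z by exact: angle_ge0.
have plt k : thp k z < alpha by exact: angle_lt.
have mlt k : thm k z < 2 * pi - alpha by exact: angle_lt.
have nexp0 s : 0 < s < 2 * pi -> expi s <> 1.
  move=> /andP[s0 s2] /expi_eq1; rewrite (ltW s0) s2 => /(_ isT) h.
  by rewrite h ltxx in s0.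
have fp k s : 0 < s < 2 * pi -> expi (theta (k * 3)%N z) = expi s <-> thp k z = s.
  move=> hs; rewrite e0; split=> [h|-> //]; move/andP: hs => [? ?].
  apply: expi_inj h; apply/andP; split; have := pge k; have := plt k; lra.
have fm k s : 0 < s < 2 * pi -> expi (theta (k * 3 + 1)%N z) = expi s <-> thm k z = 2 * pi - s.
  move=> hs; rewrite e1 -expiD2pi; move/andP: (hs) => [? ?].
  (* A reflected angle 0 is padding: it represents the eigenvalue 1, never [expi s]. *)
  have := mge k; rewrite le_eqVlt => /predU1P[k0|k0].
    rewrite -k0 oppr0 expiD2pi expi0.
    by split=> [/esym/(nexp0 _ hs)//|h]; exfalso; lra.
  split=> [h|->]; last by congr expi; lra.
  have : - thm k z + 2 * pi = s.
    by apply: expi_inj h; apply/andP; split; have := mlt k; lra.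
  lra.
have f0 k s : 0 < s < 2 * pi -> expi (theta (k * 3 + 2)%N z) <> expi s.
  by move=> hs; rewrite e2 expi0 => /esym; exact: nexp0.
split=> [s hs|]; last first.
  apply: (@infinite_image_sub (fun k => k * 3 + 2)%N) => [k l /addIn/eqP|k].
    by rewrite eqn_pmul2r // => /eqP.
  by rewrite /= e2 expi0.
move/andP: (hs) => [s0 s2].
have [sa|sa|sa] := ltgtP s alpha.
- have -> : [set j | expi (theta j z) = expi s]%classic
      = ((fun k => k * 3)%N @` [set k | angle m alpha k z = s])%classic.
    apply/seteqP; split=> [j /=|_ /= [k hk <-]]; last first.
      by apply/fp => //; rewrite /thp /= clz.
    have [k [->|->|->]] := cases j.
    + by move=> /(fp _ _ hs); rewrite /thp /= clz => h; exists k.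
    + by move=> /(fm _ _ hs) h; have := mlt k; lra.
    + by move=> /(f0 _ _ hs).
  apply: (card_eq_trans _ (angle_card hm a0 a2 z s0 sa)).
  by apply: inj_card_eq => k l _ _ /eqP; rewrite eqn_pmul2r // => /eqP.
- have -> : [set j | expi (theta j z) = expi s]%classic
      = ((fun k => k * 3 + 1)%N @` [set k | angle m' (2 * pi - alpha) k z = 2 * pi - s]%R)%classic.
    apply/seteqP; split=> [j /=|_ /= [k hk <-]]; last first.
      by apply/fm => //; rewrite /thm /= clz.
    have [k [->|->|->]] := cases j.
    + by move=> /(fp _ _ hs) h; have := plt k; lra.
    + by move=> /(fm _ _ hs); rewrite /thm /= clz => h; exists k.
    + by move=> /(f0 _ _ hs).
  have -> : m z s = m' z (2 * pi - s) by rewrite /m' reflectK.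
  have s0' : 0 < 2 * pi - s by lra.
  have sa' : 2 * pi - s < 2 * pi - alpha by lra.
  apply: (card_eq_trans _ (angle_card hm' a0' a2' z s0' sa')).
  by apply: inj_card_eq => k l _ _ /addIn/eqP; rewrite eqn_pmul2r // => /eqP.
- rewrite sa mza.
  have -> : [set j | expi (theta j z) = expi alpha]%classic = set0.
    apply/seteqP; split=> j //=; rewrite -sa; have [k [->|->|->]] := cases j.
    + by move=> /(fp _ _ hs) h; have := plt k; lra.
    + by move=> /(fm _ _ hs) h; have := mlt k; lra.
    + by move=> /(f0 _ _ hs).
  by rewrite II0 card_eqxx.
Qed.

End Enumeration.

(** The fibres of [f] and those of [g] partition the indices, so bijections chosen fibre by fibre
    combine into one. *)
Lemma fibers_bijection (C : choiceType) (f g : nat -> C) :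
  (forall lam, ([set j | f j = lam]%classic #= [set j | g j = lam]%classic)%card) ->
  exists sigma : nat -> nat, bijective sigma /\ forall j, g (sigma j) = f j.
Proof.
move=> h; have /choice[b hb] : forall lam, exists b : nat -> nat,
    set_bij [set j | f j = lam]%classic [set j | g j = lam]%classic b.
  by move=> lam; apply/card_set_bijP.
have gs j : g (b (f j) j) = f j by have [hf _ _] := hb (f j); exact: (hf j erefl).
exists (fun j => b (f j) j); split=> //; rewrite -setTT_bijective; split=> //.
- move=> j k _ _ e; have fjk : f j = f k by rewrite -[LHS]gs -[RHS]gs e.
  rewrite fjk in e; have [_ hi _] := hb (f k).
  by apply: hi e; rewrite inE.
- move=> k _; have [_ _ hs] := hb (g k).
  by have [j /= fj <-] := hs k erefl; exists j => //; rewrite fj.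
Qed.

Section EnumerationGlue.
Variables (R : realType) (m : R -> R -> nat).
Hypothesis hm : locally_constant_mult m.
Implicit Types a b c s t y : R.
Local Notation enumerates := (enumerates m).

(** At 1 both fibres are countably infinite; elsewhere on the circle both have the size [m b s]; off
    the circle both are empty. *)
Lemma enumerates_fibers a b c theta theta' : a <= b -> b <= c ->
  enumerates a b theta -> enumerates b c theta' -> forall lam,
  ([set j | expi (theta j b) = lam]%classic #= [set j | expi (theta' j b) = lam]%classic)%card.
Proof.
move=> ab bc [_ h] [_ h'] lam.
have [|h1 h2] := h b; first by rewrite ab lexx.
have [|h1' h2'] := h' b; first by rewrite bc lexx.
have [<-|lam1] := eqVneq 1 lam.
  by apply: card_eq_trans _ (card_esym _); apply: eq_card_nat.
have [[s [/andP[s0 s2] es]]|hn] := pselect (exists s : R, 0 <= s < 2 * pi /\ expi s = lam).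
  have hs : 0 < s < 2 * pi.
    rewrite s2 andbT lt_neqAle s0 andbT; apply: contra lam1 => /eqP s00.
    by rewrite -es -s00 expi0.
  by rewrite -es; apply: card_eq_trans (h1 s hs) _; apply: card_esym; exact: h1'.
have empty (th : nat -> R -> R) : [set j | expi (th j b) = lam]%classic = set0.
  apply/seteqP; split=> j //= e; apply: hn; apply: expi_surj.
  by rewrite -e csq_expi.
by rewrite !empty card_eqxx.
Qed.

Lemma enumerates_glue a b c theta theta' : a <= b -> b <= c ->
  enumerates a b theta -> enumerates b c theta' ->
  exists theta'', enumerates a c theta''.
Proof.
move=> ab bc ht ht'.
have [sigma [sb hs]] := fibers_bijection (enumerates_fibers ab bc ht ht').
have [c1 h1] := ht; have [c2 h2] := ht'.
(* [min] and [max] freeze each function outside its own interval. Beyond [b] the result is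
   [theta' (sigma j) x] shifted by the constant [theta j b - theta' (sigma j) b], a multiple of
   [2 pi]. *)
pose th j (x : R) : R := theta j (Num.min b x) +
   (theta' (sigma j) (Num.max b x) - theta' (sigma j) b).
exists th; split.
  move=> j x; rewrite /th; apply: (@continuousD _ _ _ (fun x : R => theta j (Num.min b x))
    (fun x : R => theta' (sigma j) (Num.max b x) - theta' (sigma j) b)).
    apply: (@continuous_comp _ _ _ (Num.min b) (theta j)); last exact: c1.
    exact/continuous_nonexpansive/nonexpansive_min.
  apply: (@continuousB _ _ _ (fun x : R => theta' (sigma j) (Num.max b x)) (fun=> theta' (sigma j) b)); last exact: cst_continuous.
  apply: (@continuous_comp _ _ _ (Num.max b) (theta' (sigma j))); last exact: c2.
  exact/continuous_nonexpansive/nonexpansive_max.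
move=> y /andP[ay yc]; have [yb|/ltW yb] := leP y b.
  have E lam : [set j | expi (th j y) = lam]%classic = [set j | expi (theta j y) = lam]%classic.
    by apply/seteqP; split=> k /=; rewrite /th (min_idPr yb) (max_idPl yb) subrr addr0.
  have [|h3 h4] := h1 y; first by rewrite ay.
  by split=> [s hs'|]; rewrite E //; exact: h3.
have e j : expi (th j y) = expi (theta' (sigma j) y).
  rewrite /th (min_idPl yb) (max_idPr yb) expiD -hs -expiD addrC subrK //.
have card lam : ([set j | expi (th j y) = lam]%classic #=
                 [set j | expi (theta' j y) = lam]%classic)%card.
  have [tau st ts] := sb.
  have -> : [set j | expi (th j y) = lam]%classic
     = (tau @` [set j | expi (theta' j y) = lam])%classic.
    apply/seteqP; split=> [j /=|_ /= [k hk <-]]; rewrite e ?ts //.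
    by move=> h; exists (sigma j).
  by apply: inj_card_eq => j k _ _; exact: (can_inj ts).
have [|h3 h4] := h2 y; first by rewrite yb.
split=> [s hs'|]; first exact: card_eq_trans (card _) (h3 s hs').
by move: h4; apply: contra_not; rewrite (eq_finite_set (card 1)).
Qed.

Lemma enumerates_sub a b a' b' theta : a <= a' -> b' <= b ->
  enumerates a b theta -> enumerates a' b' theta.
Proof.
move=> aa bb [h1 h2]; split=> // y /andP[? ?]; apply: h2; apply/andP; split; lra.
Qed.

Lemma enumerates_unit_interval : exists theta, enumerates 0 1 theta.
Proof.
pose S : set R := [set t | 0 <= t <= 1 /\ exists theta, enumerates 0 t theta]%classic.
have S0 : S 0.
  split; first by rewrite lexx ler01.
  have [d d0 [th hth]] := enumerates_local hm 0.
  by exists th; apply: enumerates_sub hth; lra.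
have hS : has_sup S by split; [exists 0|exists 1 => t [/andP[]]].
pose x := sup S.
have x0 : 0 <= x by exact: (ub_le_sup hS.2).
have x1 : x <= 1 by apply: (ge_sup hS.1) => t [/andP[]].
have [d d0 [th hth]] := enumerates_local hm x.
have [t [/andP[t0 t1] [th' hth']]] := sup_adherent d0 hS; rewrite -/x => xt.
have tx : t <= x by apply: (ub_le_sup hS.2); split; [rewrite t0|exists th'].
pose t' := Num.min 1 (x + d).
have [t'1 t'2] : t' <= 1 /\ t' <= x + d by split; rewrite ge_min lexx ?orbT.
have xt' : x <= t' by rewrite le_min x1 /=; lra.
have [th'' hth''] : exists th'', enumerates 0 t' th''.
  have h2 : enumerates t t' th by apply: enumerates_sub hth; lra.
  by apply: (@enumerates_glue 0 t t') hth' h2 => //; lra.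
(* The glued enumeration puts [t'] into [S]; since [d > 0], this forces [x = 1], and that
   enumeration itself reaches 1. *)
have : t' <= x.
  by apply: (ub_le_sup hS.2); split; [apply/andP; split; lra|exists th''].
rewrite ge_min => /orP[h|]; last lra.
by exists th''; apply: enumerates_sub hth''; rewrite // le_min lexx /=; lra.
Qed.

End EnumerationGlue.

(** * Eigenangle multiplicities *)

(** This translates the cardinality of a fibre into the explicit duplicate-free list of indices that
    the theorem speaks of. *)
Lemma card_eq_seqP (F : set nat) n : (F #= `I_n)%card <->
  exists s : seq nat, [/\ uniq s, size s = n & forall j, j \in s <-> F j].
Proof.
split=> [|[s [us <- hs]]].
  rewrite card_eq_sym => /card_set_bijP[f0 [ff fi fs]]; pose f : nat -> nat := f0.
  exists [seq f i | i <- iota 0 n]; split.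
  - rewrite map_inj_in_uniq ?iota_uniq // => i j; rewrite !mem_iota /= !add0n => hi hj.
    by apply: fi; rewrite inE.
  - by rewrite size_map size_iota.
  - move=> j; split=> [/mapP[k]|/fs[k hk <-]].
      by rewrite mem_iota /= add0n => hi ->; exact: ff.
    by apply: map_f; rewrite mem_iota /= add0n.
apply: card_esym; apply/card_set_bijP; exists (nth 0%N s); split.
- by move=> i hi; apply/hs; exact: mem_nth.
- by move=> i j; rewrite !inE /= => hi hj /eqP; rewrite nth_uniq // => /eqP.
- move=> j /hs js; exists (index j s); first by rewrite /= index_mem.
  exact: nth_index.
Qed.

Section EigenangleMultiplicity.
Variables (R : realType) (V : lmodType R[i]) (ip : V -> V -> R[i]).
Hypothesis hH : hilbert_space ip.
Let hip : is_inner_product ip := hH.1.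

Lemma eig_mult0 (T : V -> V) (lam : R[i]) :
  (forall v, v != 0 -> T v <> lam *: v) -> eig_mult ip T lam 0.
Proof.
move=> h; split; first by exists (fun=> 0); split=> [|[]//]; exact: orthonormal0.
case=> // m e oe he; exfalso; apply: (h (e ord0)) => //.
apply/eqP => e0; have := nsq_orthonormal oe ord0; rewrite e0 nsq0 // => /eqP.
by rewrite eq_sym oner_eq0.
Qed.

Lemma form_close_trace_norm (eps : R) (T T' : V -> V) :
  (trace_norm ip (fun v => (T v - T' v)%R) < eps%:E)%E -> form_close ip eps T T'.
Proof.
move=> h v v1; rewrite -lte_fin; apply: le_lt_trans h.
apply: ereal_sup_ubound; exists 1%N, (fun=> v), (fun=> v).
have ov : Defs.orthonormal ip (fun _ : 'I_1 => v).
  by move=> i j; rewrite !ord1 eqxx ipvv // v1.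
by split=> //; rewrite big_ord1.
Qed.

Variable W : R -> V -> V.
Hypothesis hW : forall x, in_U1 ip (W x).
Hypothesis W_cont : forall (x eps : R), 0 < eps -> exists2 delta : R, 0 < delta &
  forall y, `|x - y| < delta -> form_close ip eps (W x) (W y).

(** For [0 < s < 2 pi] a finite multiplicity exists. At the eigenvalue 1 it may be infinite, and the
    default 0 then applies. *)
Definition amult (y s : R) : nat :=
  xget 0%N [set n | eig_mult ip (W y) (expi s) n]%classic.

Lemma amultP y s : 0 < s < 2 * pi -> eig_mult ip (W y) (expi s) (amult y s).
Proof.
move=> /andP[s0 s2].
have [|||L hL] := @arc_list_exists _ _ _ hH (W y) (s / 2) ((s + 2 * pi) / 2) (hW y); [lra..|].
have := @xgetPex _ 0%N [set n | eig_mult ip (W y) (expi s) n]%classic; apply.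
exists (count_mem s L); have := hL s.
by have -> : s / 2 < s < (s + 2 * pi) / 2 by apply/andP; split; lra.
Qed.

Lemma mult_seq_arc_list y (a b : R) L : 0 < a -> a < b -> b < 2 * pi ->
  mult_seq amult y a b L <-> arc_list ip (W y) a b L.
Proof.
move=> a0 ab b2; have in2 s : a < s < b -> 0 < s < 2 * pi.
  by move=> /andP[? ?]; apply/andP; split; lra.
split=> h s; have := h s; case: ifPn => [hs|_].
- by move=> ->; apply: amultP; exact: in2.
- by move=> /count_memPn.
- by move=> e; apply: eig_mult_unique e (amultP _ (in2 _ hs)).
- by move=> /count_memPn.
Qed.

Lemma amult_locally_constant : locally_constant_mult amult.
Proof.
split=> [y a b a0 ab b2|y a b a0 ab b2 ma mb].
  have [L hL] := arc_list_exists hH (hW y) a0 ab b2.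
  by exists L; apply/mult_seq_arc_list.
have ha : eig_mult ip (W y) (expi a) 0.
  by rewrite -ma; apply: amultP; apply/andP; split; lra.
have hb : eig_mult ip (W y) (expi b) 0.
  by rewrite -mb; apply: amultP; apply/andP; split; lra.
have [eps e0 h] := arc_size_stable hH (hW y) a0 ab b2 ha hb.
have [d d0 hd] := W_cont y e0.
exists d => // z L L' /hd yz /mult_seq_arc_list-/(_ a0 ab b2) hL.
by move=> /mult_seq_arc_list-/(_ a0 ab b2) hL'; apply: h hL hL'.
Qed.

(** Values off the unit circle are neither taken by [expi] nor eigenvalues of an isometry, so the
    count for angles settles every [lam] other than 1. *)
Lemma fiber_eig_mult (y : R) (f : nat -> R) :
  (forall s, 0 < s < 2 * pi -> ([set j | expi (f j) = expi s]%classic #= `I_(amult y s))%card) ->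
  forall lam, lam != 1 -> forall n,
    ([set j | expi (f j) = lam]%classic #= `I_n)%card <-> eig_mult ip (W y) lam n.
Proof.
move=> hf lam lam1 n.
suff [k hk hk'] : exists2 k, ([set j | expi (f j) = lam]%classic #= `I_k)%card
    & eig_mult ip (W y) lam k.
  split=> [h|h]; last by rewrite -(eig_mult_unique hk' h).
  suff <- : k = n by [].
  by apply/card_eq_II; apply: card_eq_trans (card_esym hk) h.
have [l1|l1] := eqVneq (csq lam) 1.
  have [s [/andP[s0 s2] es]] := expi_surj l1.
  have hs : 0 < s < 2 * pi.
    rewrite s2 andbT lt_neqAle s0 andbT; apply: contra lam1 => /eqP s00.
    by rewrite -es -s00 expi0.
  by exists (amult y s); rewrite -es; [exact: hf|exact: amultP].
exists 0%N.
  rewrite II0 card_eq0; apply/eqP/seteqP; split=> j //= e.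
  by move: l1; rewrite -e csq_expi eqxx.
have [_ _ T_iso _] := hW y.
apply: eig_mult0 => v v0 Tv; move/eqP: l1; apply.
exact: (csq_eigenvalue hH T_iso v0 Tv).
Qed.

End EigenangleMultiplicity.

Theorem mainTheorem18 (R : realType) (V : lmodType R[i]) (ip : V -> V -> R[i])
  (hH : hilbert_space ip) (U : R -> V -> V)
  (hU1 : forall x : R, 0 <= x <= 1 -> in_U1 ip (U x))
  (hUcont : forall x : R, 0 <= x <= 1 -> forall eps : R, 0 < eps ->
     exists delta : R, 0 < delta /\ forall y : R, 0 <= y <= 1 -> `|x - y| < delta ->
       (trace_norm ip (fun v => (U x v - U y v)%R) < eps%:E)%E)
  (hU0 : forall v : V, U 0 v = v) :
  exists theta : nat -> R -> R,
    (forall j : nat, ({within `[(0:R), 1], continuous (theta j)})%classic) /\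
    (forall j : nat, theta j 0 = 0) /\
    (forall x : R, 0 <= x <= 1 ->
       (forall lam : R[i], lam != 1 -> forall n : nat,
          (exists s : seq nat, [/\ uniq s, size s = n &
                forall j : nat, j \in s <-> expi (theta j x) = lam])
          <-> eig_mult ip (U x) lam n) /\
       (forall N : nat, exists j : nat, (N <= j)%N /\ expi (theta j x) = 1)).
Proof.
(* Freezing the path outside [[0, 1]] gives a family defined at all real times, still close in the
   sense of [form_close]. *)
pose cl : R -> R := clamp 0 1.
have clin x : 0 <= cl x <= 1 by exact: clamp_in.
pose W x := U (cl x).
have hW x : in_U1 ip (W x) by exact: hU1.
have W_cont (x eps : R) : 0 < eps -> exists2 delta : R, 0 < delta &
    forall y, `|x - y| < delta -> form_close ip eps (W x) (W y).
  move=> e0; have [d [d0 h]] := hUcont _ (clin x) _ e0.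
  exists d => // y xy; apply: (form_close_trace_norm hH).
  apply: h => //; exact: (le_lt_trans (nonexpansive_clamp _ _ _ _) xy).
have [th [th_cont hth]] :=
  enumerates_unit_interval (amult_locally_constant hH hW W_cont).
have clE x : 0 <= x <= 1 -> W x = U x by move=> hx; rewrite /W /cl clamp_id.
have fib x : 0 <= x <= 1 -> forall lam : R[i], lam != 1 -> forall n,
    ([set j | expi (th j x) = lam]%classic #= `I_n)%card <-> eig_mult ip (U x) lam n.
  move=> hx; have [h _] := hth x hx; rewrite -clE //.
  exact: (fiber_eig_mult hH hW h).
(* The identity has no eigenvector for a value other than 1, so the fibre over such a value at time
   0 is empty. *)
have th0 j : expi (th j 0) = 1.
  apply/eqP; apply: contraT => l1.
  have h01 : 0 <= (0 : R) <= 1.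
    by apply/andP; split; lra.
  have [_ h] := fib 0 h01 _ l1 0%N.
  have : eig_mult ip (U 0) (expi (th j 0)) 0.
    apply: (eig_mult0 hH) => v v0; rewrite hU0 => /eqP.
    rewrite -subr_eq0 -{1}[v]scale1r -scalerBl scaler_eq0 (negPf v0) orbF.
    by rewrite subr_eq0 eq_sym (negPf l1).
  move=> /h; rewrite II0 card_eq0 => /eqP e.
  by have : [set k | expi (th k 0) = expi (th j 0)]%classic j by []; rewrite e.
(* All [th j 0] are multiples of [2 pi]; subtracting them normalizes the start without changing the
   exponentials. *)
exists (fun j x => th j x - th j 0); split; last split.
- move=> j; apply: continuous_subspaceT => x.
  apply: (@continuousB _ _ _ (th j) (fun=> th j 0)); first exact: th_cont.
  exact: cst_continuous.
- by move=> j; rewrite subrr.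
move=> x hx.
have E j : expi (th j x - th j 0) = expi (th j x).
  by rewrite expiD -conjc_expi th0 conjc1 mulr1.
split=> [lam l1 n|N].
  apply: iff_trans (fib x hx lam l1 n); apply: iff_sym.
  apply: iff_trans (card_eq_seqP _ _) _.
  by split=> -[s [us ss hs]]; exists s; split=> // j; rewrite hs /= E.
(* If no index beyond [N] gave the value 1, the fibre over 1 would lie in a finite initial
   segment. *)
have [_ inf] := hth x hx; apply: contrapT => hn; apply: inf.
apply: (@sub_finite_set _ _ `I_N); last exact: finite_II.
move=> j /= hj; rewrite ltnNge; apply/negP => Nj.
by apply: hn; exists j; rewrite E.
Qed.
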